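(* Let $\phi:\mathbb{R}^d\to\mathbb{R}$ be continuous and symmetric ($\phi(-x)=\phi(x)$ for all $x$), with $|\phi|_\infty:=\sup_{x\in[0,1]^d}\sum_{k\in\mathbb{Z}^d}|\phi(x-k)|<\infty$ and with cardinal symbol satisfying $\sigma_\phi(\zeta)>0$ for all $\zeta\in T^d$. Let $\chi$ be the Lagrange function for cardinal interpolation on $\mathbb{Z}^d$ with $\phi$ and, for a half-space lattice $H$, let $\chi_j$, $j\in H$, be the Lagrange functions for semi-cardinal interpolation on $H$ with $\phi$. (i) If $H=\mathbb{Z}^d_{\preceq,+}$, define the nested sequence $\{H_n\}_{n=0}^\infty$ of finite sets $H_n:=\{k\in H:\|k\|_2\le n\}$ and, for each $n\ge0$, let $j^{(n)}$ denote the maximum element of $H_n$ with respect to the order relation $\preceq$. Then $$\lim_{n\to\infty}\sup_{x\in\mathbb{R}^d}\left|\chi(x)-\chi_{j^{(n)}}\left(x+j^{(n)}\right)\right|=0.$$ (ii) If $H=\mathbb{Z}^{d-1}\times\mathbb{Z}_+$, then $$\lim_{j_d\to\infty}\sup_{x\in\mathbb{R}^d}|\chi(x)-\chi_{(0,j_d)}(x',x_d+j_d)|=0.$$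
   Context: Notation: $\|\cdot\|_2$ is the Euclidean norm; write $x=(x',x_d)$ with $x'\in\mathbb{R}^{d-1}$ for $d$-dimensional vectors. $T^d=\{\zeta\in\mathbb{C}^d:|\zeta_1|=\dots=|\zeta_d|=1\}$, $\zeta^k=\zeta_1^{k_1}\cdots\zeta_d^{k_d}$ for $k\in\mathbb{Z}^d$, $\zeta^{-1}=(\zeta_1^{-1},\dots,\zeta_d^{-1})$. $W=W(T^d)$ is the Wiener algebra of continuous functions $u$ on $T^d$ with absolutely summable Fourier coefficients $\{\widehat u_k\}_{k\in\mathbb{Z}^d}$, $\|u\|_W=\sum_k|\widehat u_k|$. $\mathbb{Z}_+=\{0,1,2,\dots\}$. Half-space lattice: a set $H\subset\mathbb{Z}^d$ that is either $H=\mathbb{Z}^{d-1}\times\mathbb{Z}_+$, or $H=\mathbb{Z}^d_{\preceq,+}:=\{j\in\mathbb{Z}^d:0\preceq j\}$, where $\preceq$ is a linear (total) order on $\mathbb{Z}^d$ compatible with addition ($j\preceq k$ implies $j+l\preceq k+l$). Cardinal symbol: $\sigma_\phi(\zeta)=\sum_{k\in\mathbb{Z}^d}\phi(k)\zeta^k$, $\zeta\in T^d$. Under the stated assumptions on $\phi$, $\omega:=1/\sigma_\phi\in W$ and $\log\omega\in W$; write $\omega(\zeta)=\sum_{k\in\mathbb{Z}^d}a_k\zeta^k$ and $\log\omega(\zeta)=\sum_{k\in\mathbb{Z}^d}\lambda_k\zeta^k$. The Lagrange function for cardinal interpolation is $\chi(x)=\sum_{k\in\mathbb{Z}^d}a_k\phi(x-k)$,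 $x\in\mathbb{R}^d$. Wiener-Hopf factor: if $H=\mathbb{Z}^{d-1}\times\mathbb{Z}_+$, let $\Lambda_+(\zeta)=\frac12\sum_{k'\in\mathbb{Z}^{d-1}}\lambda_{(k',0)}(\zeta')^{k'}+\sum_{k_d=1}^\infty\sum_{k'\in\mathbb{Z}^{d-1}}\lambda_k\zeta^k$; if $H=\mathbb{Z}^d_{\preceq,+}$, let $\Lambda_+(\zeta)=\frac12\lambda_0+\sum_{k\succ0}\lambda_k\zeta^k$. Set $\omega_+=\exp(\Lambda_+)$. Then $\omega(\zeta)=\omega_+(\zeta)\omega_+(\zeta^{-1})$, $\omega_+\in W$, and its Fourier coefficients are supported on $H$: $\omega_+(\zeta)=\sum_{k\in H}\gamma_k\zeta^k$. Semi-cardinal symbols: let $P_+\{\sum_{k\in\mathbb{Z}^d}\widehat\psi_k\zeta^k\}=\sum_{k\in H}\widehat\psi_k\zeta^k$ for $\psi\in W$. For $j\in H$, $\omega_j(\zeta):=\omega_+(\zeta)\,P_+\{\zeta^j\omega_+(\zeta^{-1})\}$, which lies in $W$ with Fourier coefficients supported on $H$: $\omega_j(\zeta)=\sum_{k\in H}a_{k,j}\zeta^k$. Lagrange functions for semi-cardinal interpolation on $H$: $\chi_j(x)=\sum_{k\in H}a_{k,j}\phi(x-k)$, $x\in\mathbb{R}^d$, $j\in H$. *)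

(* Defs.v *)
From mathcomp Require Import all_boot all_order all_algebra.
From mathcomp Require Import complex.
From mathcomp Require Import all_classical all_reals all_analysis.

Set Implicit Arguments.
Unset Strict Implicit.
Unset Printing Implicit Defensive.
Import Order.TTheory GRing.Theory Num.Theory.
Import numFieldNormedType.Exports.

Local Open Scope classical_set_scope.
Local Open Scope ring_scope.
Local Open Scope complex_scope.

(* The dimension is [d.+1], so that it is at least 1. Points of R^d, of C^d and
   of Z^d are row vectors over [R], [R[i]] and [int]; the last coordinate is the
   one with index [ord_max]. *)

Section Sums.
Context {R : realType} {T : choiceType}.

(* Unconditional sums; meaningful for absolutely summable families. *)
Definition rsum (D : set T) (f : T -> R) : R :=
  fine (esum D (EFin \o f)^\+ - esum D (EFin \o f)^\-)%E.

Definition csum (D : set T) (f : T -> R[i]) : R[i] :=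
  rsum D (fun k => complex.Re (f k)) +i* rsum D (fun k => complex.Im (f k)).

End Sums.

Section Torus.
Context {R : realType}.

Definition cexp (z : R[i]) : R[i] :=
  (expR (complex.Re z))%:C * (cos (complex.Im z) +i* sin (complex.Im z)).

Definition torus d : set 'rV[R[i]]_d := [set z | forall i, `|z 0 i| = 1].

Definition monomial d (k : 'rV[int]_d) (z : 'rV[R[i]]_d) : R[i] :=
  \prod_(i < d) z 0 i ^ k 0 i.

Definition vinv d (z : 'rV[R[i]]_d) : 'rV[R[i]]_d := map_mx GRing.inv z.

(* Integral over [0,1]^d as an iterated Lebesgue integral; for continuous
   integrands this is the d-dimensional integral, by Fubini's theorem. *)
Fixpoint cube_integral (d : nat) : ('rV[R]_d -> R) -> R :=
  match d with
  | 0 => fun f => f 0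
  | d'.+1 => fun f =>
      \int[lebesgue_measure]_(t in `[0, 1]%classic)
        @cube_integral d' (fun s => f (row_mx (t%:M : 'rV[R]_1) s))
  end.

Definition torus_pt d (t : 'rV[R]_d) : 'rV[R[i]]_d :=
  map_mx (fun s : R => cexp (0 +i* (2 * pi * s))) t.

Definition fourier_coef d (u : 'rV[R[i]]_d -> R[i]) (k : 'rV[int]_d) : R[i] :=
  let g t := u (torus_pt t) * monomial (- k) (torus_pt t) in
  cube_integral (fun t => complex.Re (g t))
    +i* cube_integral (fun t => complex.Im (g t)).

End Torus.

Definition lattice_order d (le : rel 'rV[int]_d) : Prop :=
  [/\ total le, antisymmetric le, transitive le
    & forall j k l, le j k -> le (j + l) (k + l)].

(* [ProductHalf d] is Z^(d-1) x Z_+ and [OrderedHalf le] is {j | 0 `le` j};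
   these are half-space lattices when [lattice_order le] holds. *)
Variant half_space (d : nat) :=
  | ProductHalf
  | OrderedHalf of rel 'rV[int]_d.+1.

Definition half_lattice d (H : half_space d) : set 'rV[int]_d.+1 :=
  match H with
  | ProductHalf => [set k | 0 <= k 0 ord_max]
  | OrderedHalf le => [set k | le 0 k]
  end.

Section Interpolation.
Context {R : realType} {d : nat}.
Variable phi : 'rV[R]_d.+1 -> R.

Definition lattice_pt (k : 'rV[int]_d.+1) : 'rV[R]_d.+1 :=
  map_mx (fun m : int => m%:~R) k.

Definition shift_norm : \bar R :=
  ereal_sup
    [set (\esum_(k in [set: 'rV[int]_d.+1]) `|phi (x - lattice_pt k)|%:E)%E
      | x in [set x : 'rV[R]_d.+1 | forall i, 0 <= x 0 i <= 1]].

Definition cardinal_symbol (z : 'rV[R[i]]_d.+1) : R[i] :=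
  csum setT (fun k => (phi (lattice_pt k))%:C * monomial k z).

Definition omega (z : 'rV[R[i]]_d.+1) : R[i] := (cardinal_symbol z)^-1.

(* [omega] is real and positive on the torus when [cardinal_symbol] is, so the
   logarithm is the real one. *)
Definition log_omega (z : 'rV[R[i]]_d.+1) : R[i] :=
  (ln (complex.Re (omega z)))%:C.

Definition lagrange (x : 'rV[R]_d.+1) : R[i] :=
  csum setT (fun k => fourier_coef omega k * (phi (x - lattice_pt k))%:C).

Section SemiCardinal.
Variable H : half_space d.

Definition Lambda_plus (z : 'rV[R[i]]_d.+1) : R[i] :=
  let term k := fourier_coef log_omega k * monomial k z in
  match H with
  | ProductHalf =>
      2^-1 * csum [set k : 'rV[int]_d.+1 | k 0 ord_max = 0] term
      + csum [set k : 'rV[int]_d.+1 | 0 < k 0 ord_max] term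
  | OrderedHalf le =>
      2^-1 * fourier_coef log_omega 0
      + csum [set k : 'rV[int]_d.+1 | le 0 k /\ k <> 0] term
  end.

Definition omega_plus (z : 'rV[R[i]]_d.+1) : R[i] := cexp (Lambda_plus z).

Definition P_plus (psi : 'rV[R[i]]_d.+1 -> R[i]) (z : 'rV[R[i]]_d.+1) : R[i] :=
  csum (half_lattice H) (fun k => fourier_coef psi k * monomial k z).

Definition semi_symbol (j : 'rV[int]_d.+1) (z : 'rV[R[i]]_d.+1) : R[i] :=
  omega_plus z * P_plus (fun y => monomial j y * omega_plus (vinv y)) z.

Definition semi_lagrange (j : 'rV[int]_d.+1) (x : 'rV[R]_d.+1) : R[i] :=
  csum (half_lattice H)
    (fun k => fourier_coef (semi_symbol j) k * (phi (x - lattice_pt k))%:C).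

Definition sup_deviation (j : 'rV[int]_d.+1) : \bar R :=
  ereal_sup
    [set (ComplexField.Normc.normc
            (lagrange x - semi_lagrange j (x + lattice_pt j)))%:E
      | x in [set: 'rV[R]_d.+1]].

End SemiCardinal.
End Interpolation.

Section FiniteSections.
Variable R : realType.
Context {d : nat}.

Definition enorm (x : 'rV[R]_d.+1) : R := Num.sqrt (\sum_i x 0 i ^+ 2).

Definition finite_section (H : half_space d) (n : nat) : set 'rV[int]_d.+1 :=
  [set k | half_lattice H k /\ enorm (lattice_pt k) <= n%:R].

End FiniteSections.

Definition is_maximum d (le : rel 'rV[int]_d) (A : set 'rV[int]_d)
    (j : 'rV[int]_d) : Prop :=
  A j /\ forall k, A k -> le k j.

(* The lattice point (0, n) with 0 in Z^(d-1). *)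
Definition vertical_pt d (n : nat) : 'rV[int]_d.+1 :=
  \row_i (if i == ord_max then n%:Z else 0).

(* Main.v *)
Require Import Defs.
From mathcomp Require Import all_boot all_order all_algebra.
From mathcomp Require Import complex.
From mathcomp Require Import all_classical all_reals all_analysis.
From mathcomp Require Import ring lra zify.
Import Order.TTheory GRing.Theory Num.Theory.
Import numFieldNormedType.Exports.

(* Let W be the algebra of absolutely convergent Fourier series. For g in W the
   growth rate of the norms of g^n in W is governed by sup |g| alone: up to a small
   remainder g is a trigonometric polynomial, and the n-th power of a trigonometric
   polynomial p has O(n^d) coefficients, each at most sup |p|^n. Hence, writing the
   symbol as M(1 - g) with 0 <= g <= r < 1, the series of log(1 - g) converges in W.
   So log omega lies in W, and exponentiating its half on H gives omega_+ in W, with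
   coefficients gamma supported on H. The coefficients of P_+(z^j omega_+(1/z)) are
   gamma(j - k), k in H, so

     omega - z^-j omega_j = omega_+(z) * sum_(m in H, j - m notin H) gamma_m z^-m.

   The deviation is therefore at most a constant times the l1 norm of the gamma_m
   with j - m outside H, which vanishes as soon as each fixed m in H eventually
   satisfies j - m in H. *)

Set Implicit Arguments.
Unset Strict Implicit.
Unset Printing Implicit Defensive.

Local Open Scope classical_set_scope.
Local Open Scope ring_scope.
Local Open Scope complex_scope.

Import ComplexField.Normc.

(** * Unconditional sums *)

Section RealSums.
Context {R : realType}.

(** The obstacle is that the norm of g in W, unlike its supremum, may be at least 1, so the
    logarithm series cannot be bounded by powers of that norm. The exponential series converges
    everywhere and has no such difficulty. Wiener's lemma on 1/f is not a separate step: once log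
    omega lies in W, omega is recovered as a product of two exponentials, and its coefficients come
    with it. Coefficients are defined by iterated integrals, so each function whose coefficients are
    needed is exhibited as an absolutely convergent series, and integration against characters
    recovers them. The displayed identity comes from splitting omega_+(1/z) = sum gamma_m z^-m
    according to whether j - m lies in H. The terms with j - m in H are, after the reflection m = j
    - k, exactly z^-j P_+(z^j omega_+(1/z)). Both kinds of H are treated together through a weight w
    supported on H with w(k) + w(-k) = 1. *)

Definition rsummable (T : choiceType) (f : T -> R) : Prop :=
  (\esum_(k in [set: T]) `|f k|%:E < +oo)%E.

Section OneType.
Context {T : choiceType}.
Implicit Types f g h : T -> R.

Lemma le_rsummable f g : (forall k, `|f k| <= `|g k|) -> rsummable g -> rsummable f.
Proof.
move=> fg; apply: le_lt_trans; apply: le_esum => k _.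
by rewrite lee_fin.
Qed.

Lemma rsummableD f g : rsummable f -> rsummable g -> rsummable (fun k => f k + g k).
Proof.
move=> sf sg; apply: le_lt_trans (lte_add_pinfty sf sg).
rewrite -esumD => [|k _|k _]; rewrite ?lee_fin//.
by apply: le_esum => k _; rewrite -EFinD lee_fin ler_normD.
Qed.

Lemma esumZ (c : R) f : 0 <= c -> (forall k, 0 <= f k) ->
  (\esum_(k in [set: T]) (c * f k)%:E = c%:E * \esum_(k in [set: T]) (f k)%:E)%E.
Proof.
have le_Z c' f' : 0 < c' -> (c'%:E * (\esum_(k in [set: T]) (f' k)%:E)
    <= \esum_(k in [set: T]) (c' * f' k)%:E)%E.
  move=> c0.
  rewrite -lee_pdivlMl//; apply: ge_ereal_sup => _ [X XT <-].
  rewrite lee_pdivlMl//; apply: esum_ge; exists X => //.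
  rewrite !fsumEFin ?lee_fin; [|exact: XT.1|exact: XT.1].
  by rewrite mulr_fsumr.
rewrite le_eqVlt => /predU1P[<-|c0] f0.
  by rewrite mul0e esum1// => k _; rewrite mul0r.
apply/eqP; rewrite eq_le le_Z// andbT.
(* The reverse inequality is [le_Z] again, for the factor [c^-1] and the family [c * f]. *)
rewrite -[leLHS]mul1e -(@mulfV _ c) ?gt_eqF// EFinM -muleA lee_pmul2l//.
have := @le_Z c^-1 (fun k => c * f k); rewrite invr_gt0 => /(_ c0)/le_trans; apply.
by apply: le_esum => k _; rewrite mulrA mulVf ?gt_eqF// mul1r.
Qed.

Lemma rsummableZ (c : R) f : rsummable f -> rsummable (fun k => c * f k).
Proof.
rewrite /rsummable => sf; under eq_esum do rewrite normrM.
by rewrite esumZ// lte_mul_pinfty// lee_fin.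
Qed.

Lemma ge0_rsummable_fin f : rsummable f -> (forall k, 0 <= f k) ->
  (\esum_(k in [set: T]) (f k)%:E)%E \is a fin_num.
Proof.
move=> sf f0; rewrite ge0_fin_numE; last by apply: esum_ge0 => k _; rewrite lee_fin.
by apply: le_lt_trans sf; apply: le_esum => k _; rewrite lee_fin ler_norm.
Qed.

Lemma rsumB g h : rsummable g -> rsummable h ->
  (forall k, 0 <= g k) -> (forall k, 0 <= h k) ->
  rsum setT (fun k => g k - h k) =
  fine (\esum_(k in [set: T]) (g k)%:E) - fine (\esum_(k in [set: T]) (h k)%:E).
Proof.
move=> sg sh g0 h0; rewrite /rsum.
have -> : EFin \o (fun k => g k - h k) = ((EFin \o g) \- (EFin \o h))%E by apply/funext.
rewrite esumB// => [|i _|i _]; rewrite ?lee_fin//.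
by rewrite fineB// ge0_rsummable_fin.
Qed.

Lemma ge0_rsum f : rsummable f -> (forall k, 0 <= f k) ->
  rsum setT f = fine (\esum_(k in [set: T]) (f k)%:E).
Proof.
move=> sf f0; have s0 : rsummable (fun _ : T => 0 : R).
  by rewrite /rsummable esum1// => k _; rewrite normr0.
rewrite -[LHS]/(rsum setT (fun k => f k)).
under eq_fun do rewrite -[f _]subr0.
by rewrite rsumB// (@esum1 _ _ _ (fun=> 0%:E))// subr0.
Qed.

Lemma rsummable_norm f : rsummable f -> rsummable (fun k => `|f k|).
Proof. by apply: le_rsummable => k; rewrite normr_id. Qed.

Lemma rsummable_normB f : rsummable f -> rsummable (fun k => `|f k| - f k).
Proof.
move=> sf; have := rsummableD (rsummable_norm sf) (rsummableZ (-1) sf).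
by apply: le_rsummable => k; rewrite mulN1r.
Qed.

Lemma normB_ge0 (x : R) : 0 <= `|x| - x.
Proof. by rewrite subr_ge0 ler_norm. Qed.

(* Writing f as |f| - (|f| - f) reduces signed sums to sums of nonnegative
   families. *)
Lemma rsumE f : rsummable f -> rsum setT f =
  fine (\esum_(k in [set: T]) `|f k|%:E) -
  fine (\esum_(k in [set: T]) (`|f k| - f k)%:E).
Proof.
move=> sf; rewrite -rsumB//.
- by congr rsum; apply/funext => k; rewrite subKr.
- exact: rsummable_norm.
- exact: rsummable_normB.
- by move=> k; exact: normB_ge0.
Qed.

Lemma rsumD f g : rsummable f -> rsummable g ->
  rsum setT (fun k => f k + g k) = rsum setT f + rsum setT g.
Proof.
move=> sf sg; rewrite (rsumE sf) (rsumE sg).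
have [sf1 sg1] := (rsummable_norm sf, rsummable_norm sg).
have [sf2 sg2] := (rsummable_normB sf, rsummable_normB sg).
transitivity (rsum setT (fun k => (`|f k| + `|g k|) -
  ((`|f k| - f k) + (`|g k| - g k)))).
  by congr rsum; apply/funext => k; ring.
rewrite rsumB; last 4 first.
- exact: rsummableD.
- exact: rsummableD.
- by move=> k; rewrite addr_ge0.
- by move=> k; rewrite addr_ge0// normB_ge0.
have E a b : rsummable a -> rsummable b -> (forall k, 0 <= a k) ->
    (forall k, 0 <= b k) -> fine (\esum_(k in [set: T]) (a k + b k)%:E) =
    fine (\esum_(k in [set: T]) (a k)%:E) + fine (\esum_(k in [set: T]) (b k)%:E).
  move=> sa sb a0 b0; rewrite -fineD ?ge0_rsummable_fin// -esumD => [|k _|k _];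
    by rewrite ?lee_fin.
rewrite (E _ _ sf1 sg1)// (E _ _ sf2 sg2); first by ring.
- by move=> k; exact: normB_ge0.
- by move=> k; exact: normB_ge0.
Qed.

Lemma rsumZ (c : R) f : rsummable f ->
  rsum setT (fun k => c * f k) = c * rsum setT f.
Proof.
move=> sf.
have pos a : 0 <= a -> rsum setT (fun k => a * f k) = a * rsum setT f.
  move=> a0; rewrite (rsumE sf).
  transitivity (rsum setT (fun k => a * `|f k| - a * (`|f k| - f k))).
    by congr rsum; apply/funext => k; ring.
  have [sf1 sf2] := (rsummable_norm sf, rsummable_normB sf).
  rewrite rsumB; [|exact: rsummableZ|exact: rsummableZ|..]; last 2 first.
  - by move=> k; rewrite mulr_ge0.
  - by move=> k; rewrite mulr_ge0// normB_ge0.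
  rewrite !esumZ// => [|k]; last exact: normB_ge0.
  rewrite !fineM ?ge0_rsummable_fin//; last by move=> k; exact: normB_ge0.
  by rewrite mulrBr.
have [c0|c0] := leP 0 c; first exact: pos.
(* For negative [c] the families [c * f] and [- c * f] add up to zero, which reduces the claim to
   the positive factor [- c]. *)
have := rsumD (rsummableZ c sf) (rsummableZ (- c) sf).
rewrite (pos (- c)) ?oppr_ge0 1?ltW//.
have -> : (fun k => c * f k + - c * f k) = (fun=> 0).
  by apply/funext => k; ring.
rewrite ge0_rsum// ?esum1//; last by rewrite /rsummable esum1// => k _; rewrite normr0.
by move=> /eqP; rewrite eq_sym mulNr subr_eq add0r => /eqP.
Qed.

Lemma ge0_rsum_ge0 f : rsummable f -> (forall k, 0 <= f k) -> 0 <= rsum setT f.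
Proof.
by move=> sf f0; rewrite ge0_rsum// fine_ge0// esum_ge0// => k _; rewrite lee_fin.
Qed.

Lemma le_rsum f g : rsummable f -> rsummable g -> (forall k, f k <= g k) ->
  rsum setT f <= rsum setT g.
Proof.
move=> sf sg fg; rewrite -subr_ge0.
have sN : rsummable (fun k => - f k).
  by apply: le_rsummable sf => k; rewrite normrN.
have -> : - rsum setT f = rsum setT (fun k => - f k).
  rewrite -mulN1r -rsumZ//; congr rsum; apply/funext => k; exact: mulN1r.
rewrite -rsumD//; apply: ge0_rsum_ge0; first exact: rsummableD.
by move=> k; rewrite subr_ge0.
Qed.

Lemma rsum_delta (i : T) (c : R) : rsum setT (fun k => if k == i then c else 0) = c.
Proof.
have pos (a : R) : 0 <= a -> (\esum_(k in [set: T]) (if k == i then a else 0)%:E = a%:E)%E.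
  move=> a0; rewrite -[RHS](@esum_set1 R T i (fun=> a%:E))// [RHS]esum_mkcond.
  by apply: eq_esum => k _; rewrite in_set1; case: eqP.
have s : rsummable (fun k => if k == i then c else 0).
  rewrite /rsummable (_ : (fun k => _) = fun k => (if k == i then `|c| else 0)%:E).
    by rewrite pos// ltry.
  by apply/funext => k; case: eqP; rewrite ?normr0.
have s1 : rsummable (fun k => if k == i then 1 : R else 0).
  rewrite /rsummable (_ : (fun k => _) = fun k => (if k == i then 1 else 0)%:E).
    by rewrite pos// ltry.
  by apply/funext => k; case: eqP; rewrite ?normr0 ?normr1.
transitivity (rsum setT (fun k => c * (if k == i then 1 else 0))).
  by congr rsum; apply/funext => k; case: eqP; rewrite ?mulr1 ?mulr0.
by rewrite rsumZ// ge0_rsum// ?pos ?mulr1// => k; case: eqP.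
Qed.

End OneType.

Lemma reindex_rsum (T T' : choiceType) (e : T -> T') (f : T' -> R) :
  bijective e -> rsum setT f = rsum setT (f \o e).
Proof.
rewrite -setTT_bijective => be.
rewrite /rsum (reindex_esum [set: T] [set: T'] e)//.
rewrite (reindex_esum [set: T] [set: T'] e (EFin \o f)^\-%E)//.
by congr (fine (_ - _)); apply: eq_esum => i _; rewrite ?funeposE ?funenegE.
Qed.

Section Fubini.
Context {T1 T2 : choiceType}.
Variable f : T1 * T2 -> R.
Hypothesis sf : rsummable f.

Let esum_pair (g : T1 * T2 -> R) : (forall k, 0 <= g k) ->
  (\esum_(k in [set: T1 * T2]) (g k)%:E =
   \esum_(i in [set: T1]) \esum_(j in [set: T2]) (g (i, j))%:E)%E.
Proof.
move=> g0; rewrite (@esum_esum R T1 T2 setT (fun=> setT) (fun i j => (g (i, j))%:E)).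
  rewrite (_ : _ `*`` _ = [set: T1 * T2]); last by apply/seteqP; split.
  by apply: eq_esum => -[].
by move=> i j _ _; rewrite lee_fin.
Qed.

Lemma rsummable_inner i : rsummable (fun j => f (i, j)).
Proof.
have := sf; rewrite /rsummable (@esum_pair (fun k => `|f k|))//; apply: le_lt_trans.
apply: esum_ge; exists [set i]; first by split.
by rewrite fsbig_set1.
Qed.

Let pos_outer (g : T1 * T2 -> R) : (forall k, 0 <= g k) -> rsummable g ->
  (forall i, rsummable (fun j => g (i, j))) ->
  rsummable (fun i => fine (\esum_(j in [set: T2]) (g (i, j))%:E)) /\
  (\esum_(k in [set: T1 * T2]) (g k)%:E =
   \esum_(i in [set: T1]) (fine (\esum_(j in [set: T2]) (g (i, j))%:E))%:E)%E.
Proof.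
move=> g0 sg ig.
have E : (\esum_(k in [set: T1 * T2]) (g k)%:E =
   \esum_(i in [set: T1]) (fine (\esum_(j in [set: T2]) (g (i, j))%:E))%:E)%E.
  by rewrite esum_pair//; apply: eq_esum => i _; rewrite fineK// ge0_rsummable_fin.
split=> //; rewrite /rsummable.
have Q i : 0 <= fine (\esum_(j in [set: T2]) (g (i, j))%:E).
  by rewrite fine_ge0// esum_ge0// => j _; rewrite lee_fin.
under eq_esum do rewrite (ger0_norm (Q _)).
rewrite -E; move: sg; rewrite /rsummable.
by under eq_esum do rewrite (ger0_norm (g0 _)).
Qed.

(** Tonelli's theorem applies to the nonnegative families [|f|] and [|f| - f] separately. Their
    inner sums are finite by [rsummable_inner], so taking [fine] loses nothing. *)
Lemma fubini_rsum : rsummable (fun i => rsum setT (fun j => f (i, j))) /\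
  rsum setT f = rsum setT (fun i => rsum setT (fun j => f (i, j))).
Proof.
have H1 := pos_outer (g := fun k => `|f k|) (fun k => normr_ge0 _)
  (rsummable_norm sf) (fun i => rsummable_norm (rsummable_inner i)).
have H2 := pos_outer (g := fun k => `|f k| - f k) (fun k => normB_ge0 _)
  (rsummable_normB sf) (fun i => rsummable_normB (rsummable_inner i)).
have E : (fun i => rsum setT (fun j => f (i, j))) = (fun i =>
   fine (\esum_(j in [set: T2]) `|f (i, j)|%:E) -
   fine (\esum_(j in [set: T2]) (`|f (i, j)| - f (i, j))%:E)).
  by apply/funext => i; rewrite rsumE//; exact: rsummable_inner.
rewrite E; split.
  have := rsummableD H1.1 (rsummableZ (-1) H2.1).
  by apply: le_rsummable => i; rewrite mulN1r.
rewrite rsumB; [|exact: H1.1|exact: H2.1|..].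
- by rewrite rsumE// H1.2 H2.2.
- by move=> i; rewrite fine_ge0// esum_ge0// => j _; rewrite lee_fin.
- by move=> i; rewrite fine_ge0// esum_ge0// => j _; rewrite lee_fin normB_ge0.
Qed.

End Fubini.
End RealSums.

Section ComplexNorm.
Context {R : realType}.
Implicit Types x y z : R[i].

Lemma normcE z : `|z| = (normc z)%:C.
Proof. by []. Qed.

Lemma normc_ge0 z : 0 <= normc z.
Proof. by case: z => a b; exact: sqrtr_ge0. Qed.

Lemma normc_triangle x y : normc (x + y) <= normc x + normc y.
Proof. by rewrite -lecR rmorphD; exact: (@ler_normD _ R[i] x y). Qed.

Lemma normc_opp z : normc (- z) = normc z.
Proof. by apply: complexI; rewrite -!normcE normrN. Qed.

Lemma normc_exp z n : normc (z ^+ n) = normc z ^+ n.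
Proof. by elim: n => [|n IH]; rewrite ?normc1// !exprS normcM IH. Qed.

Lemma normcR (a : R) : normc a%:C = `|a|.
Proof. by rewrite /normc /= expr0n/= addr0 sqrtr_sqr. Qed.

Lemma cReM x y :
  complex.Re (x * y) = complex.Re x * complex.Re y - complex.Im x * complex.Im y.
Proof. by case: x y => [a b] [c d]. Qed.

Lemma cImM x y :
  complex.Im (x * y) = complex.Re x * complex.Im y + complex.Im x * complex.Re y.
Proof. by case: x y => [a b] [c d]. Qed.

Lemma cReD x y : complex.Re (x + y) = complex.Re x + complex.Re y.
Proof. by case: x y => [a b] [c d]. Qed.

Lemma cImD x y : complex.Im (x + y) = complex.Im x + complex.Im y.
Proof. by case: x y => [a b] [c d]. Qed.

Lemma complexP x y :
  complex.Re x = complex.Re y -> complex.Im x = complex.Im y -> x = y.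
Proof. by case: x y => [a b] [c d] /= -> ->. Qed.

Lemma normr_Re z : `|complex.Re z| <= normc z.
Proof.
case: z => a b /=; rewrite -[leLHS]sqrtr_sqr ler_wsqrtr// lerDl sqr_ge0//.
Qed.

Lemma normr_Im z : `|complex.Im z| <= normc z.
Proof.
case: z => a b /=; rewrite -[leLHS]sqrtr_sqr ler_wsqrtr// lerDr sqr_ge0//.
Qed.

End ComplexNorm.

(** * Absolutely summable complex families *)

Section ComplexSums.
Context {R : realType}.

Definition l1 (T : choiceType) (f : T -> R[i]) : \bar R :=
  (\esum_(k in [set: T]) (normc (f k))%:E)%E.

Definition csummable (T : choiceType) (f : T -> R[i]) : Prop := (l1 f < +oo)%E.

Section OneType.
Context {T : choiceType}.
Implicit Types (f g : T -> R[i]) (D : set T).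

Lemma l1_ge0 f : (0 <= l1 f)%E.
Proof. by apply: esum_ge0 => k _; rewrite lee_fin normc_ge0. Qed.

Lemma le_l1 f g : (forall k, normc (f k) <= normc (g k)) -> (l1 f <= l1 g)%E.
Proof. by move=> fg; apply: le_esum => k _; rewrite lee_fin. Qed.

Lemma csummable_le f (M : R) : (l1 f <= M%:E)%E -> csummable f.
Proof. by move=> /le_lt_trans; apply; rewrite ltry. Qed.

Lemma le_csummable f g :
  (forall k, normc (f k) <= normc (g k)) -> csummable g -> csummable f.
Proof. by move=> /le_l1; exact: le_lt_trans. Qed.

Lemma csummableE f : csummable f -> l1 f = (fine (l1 f))%:E.
Proof. by move=> sf; rewrite fineK// ge0_fin_numE// l1_ge0. Qed.

Lemma l1D f g : (l1 (fun k => (f k + g k)%R) <= l1 f + l1 g)%E.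
Proof.
rewrite /l1 -esumD => [|k _|k _]; rewrite ?lee_fin ?normc_ge0//.
by apply: le_esum => k _; rewrite -EFinD lee_fin normc_triangle.
Qed.

Lemma l1Z (c : R[i]) f : l1 (fun k => c * f k) = ((normc c)%:E * l1 f)%E.
Proof.
rewrite /l1; under eq_esum do rewrite normcM.
by rewrite esumZ ?normc_ge0// => k; rewrite normc_ge0.
Qed.

Lemma csummableD f g : csummable f -> csummable g -> csummable (fun k => f k + g k).
Proof. by move=> sf sg; apply: le_lt_trans (l1D _ _) _; rewrite lte_add_pinfty. Qed.

Lemma csummableZ (c : R[i]) f : csummable f -> csummable (fun k => c * f k).
Proof. by move=> sf; rewrite /csummable l1Z lte_mul_pinfty// lee_fin normc_ge0. Qed.

Lemma normc_le_l1 f k : ((normc (f k))%:E <= l1 f)%E.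
Proof.
by apply: esum_ge; exists [set k]; [split|rewrite fsbig_set1].
Qed.

Lemma csummable_Re f : csummable f -> rsummable (fun k => complex.Re (f k)).
Proof.
by apply: le_lt_trans; apply: le_esum => k _; rewrite lee_fin normr_Re.
Qed.

Lemma csummable_Im f : csummable f -> rsummable (fun k => complex.Im (f k)).
Proof.
by apply: le_lt_trans; apply: le_esum => k _; rewrite lee_fin normr_Im.
Qed.

Lemma csummable_norm f : csummable f -> rsummable (fun k => normc (f k)).
Proof.
by rewrite /rsummable; under eq_esum do rewrite (ger0_norm (normc_ge0 _)).
Qed.

Lemma csumD f g : csummable f -> csummable g ->
  csum setT (fun k => f k + g k) = csum setT f + csum setT g.
Proof.
move=> sf sg; rewrite /csum; apply: complexP; rewrite ?cReD ?cImD /=.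
  under eq_fun do rewrite cReD.
  by rewrite rsumD//; exact: csummable_Re.
under eq_fun do rewrite cImD.
by rewrite rsumD//; exact: csummable_Im.
Qed.

Lemma csumZ (c : R[i]) f : csummable f ->
  csum setT (fun k => c * f k) = c * csum setT f.
Proof.
move=> sf; have [sr si] := (csummable_Re sf, csummable_Im sf).
rewrite /csum; apply: complexP; rewrite ?cReM ?cImM /=.
  under eq_fun do rewrite cReM -mulNr.
  by rewrite rsumD ?rsumZ// ?mulNr//; exact: rsummableZ.
under eq_fun do rewrite cImM.
by rewrite rsumD ?rsumZ//; exact: rsummableZ.
Qed.

Lemma csumN f : csummable f -> csum setT (fun k => - f k) = - csum setT f.
Proof.
move=> sf; rewrite -[RHS]mulN1r -csumZ//; congr csum.
by apply/funext => k; rewrite mulN1r.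
Qed.

(* Rotating f by the conjugate phase of its sum s makes the sum equal to |s|, so
   that only real parts have to be compared. *)
Lemma normc_csum f (M : R) : (l1 f <= M%:E)%E -> normc (csum setT f) <= M.
Proof.
move=> fM; have sf := csummable_le fM; set s := csum _ _.
have [->|s0] := eqVneq s 0.
  by rewrite normc0 -lee_fin (le_trans (l1_ge0 f)).
have ns0 : normc s != 0 by apply: contra s0 => /eqP/eq0_normc ->.
pose u : R[i] := (normc s)%:C * s^-1.
have nu : normc u = 1.
  by rewrite /u normcM normcV normcR ger0_norm ?normc_ge0// divff.
have us : csum setT (fun k => u * f k) = (normc s)%:C.
  by rewrite csumZ// -/s /u mulfVK.
have -> : normc s = complex.Re (csum setT (fun k => u * f k)) by rewrite us.
have su := csummableZ u sf.
apply: (@le_trans _ _ (rsum setT (fun k => normc (f k)))).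
  apply: le_rsum => [||k]; [exact: csummable_Re|exact: csummable_norm|].
  apply: le_trans (ler_norm _) _; apply: le_trans (normr_Re _) _.
  by rewrite normcM nu mul1r.
rewrite ge0_rsum; [|exact: csummable_norm|by move=> k; exact: normc_ge0].
by rewrite -lee_fin -csummableE.
Qed.

Lemma csum0 : csum [set: T] (fun=> 0) = 0 :> R[i].
Proof.
apply/eq0_normc/eqP; rewrite eq_le normc_ge0 andbT; apply: normc_csum.
by rewrite /l1 esum1// => k _; rewrite normc0.
Qed.

Lemma csum_delta (i : T) (c : R[i]) : csum setT (fun k => if k == i then c else 0) = c.
Proof.
rewrite /csum; apply: complexP => /=.
  by rewrite -[RHS](rsum_delta i); congr rsum; apply/funext => k; case: eqP.
by rewrite -[RHS](rsum_delta i); congr rsum; apply/funext => k; case: eqP.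
Qed.

Lemma csummable_fin (s : seq T) f : csummable (fun k => if k \in s then f k else 0).
Proof.
have -> : (fun k => if k \in s then f k else 0) =
    (fun k => if k \in [set` s] then f k else 0).
  by apply/funext => k; rewrite mem_setE.
rewrite /csummable /l1.
rewrite (_ : (fun k => _) = fun k =>
    if k \in [set` s] then (normc (f k))%:E else 0%E); last first.
  by apply/funext => k; case: ifP => //; rewrite normc0.
rewrite -esum_mkcond esum_fset => [||k _]; [|exact: finite_seq|]; last first.
  by rewrite lee_fin normc_ge0.
by rewrite fsumEFin ?ltry//; exact: finite_seq.
Qed.

Lemma csum_seq (s : seq T) f : uniq s ->
  csum setT (fun k => if k \in s then f k else 0) = \sum_(k <- s) f k.
Proof.
elim: s => [_|i s IH /= /andP[si us]].
  by rewrite big_nil -[RHS]csum0; congr csum.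
rewrite big_cons -IH// -[f i in RHS](csum_delta i) -csumD.
- congr csum; apply/funext => k; rewrite inE.
  case: eqVneq => [->|_] /=; last by rewrite add0r.
  by rewrite (negbTE si) addr0.
- have := csummable_fin [:: i] (fun=> f i).
  by apply: le_csummable => k; rewrite inE.
- exact: csummable_fin.
Qed.

(** The norm is a supremum over finite sets, so some finite set carries all of it but [e]. Every
    approximation by trigonometric polynomials starts here. *)
Lemma csummable_tail f (e : R) : csummable f -> 0 < e ->
  exists2 s : seq T, uniq s & (l1 (fun k => if k \in s then 0%R else f k) <= e%:E)%E.
Proof.
move=> sf e0.
have : (l1 f - e%:E < l1 f)%E.
  by rewrite (csummableE sf) -EFinB lte_fin ltrBlDr ltrDl.
move=> /ereal_sup_gt[_ [F [finF _] <-]] ltF.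
exists (finmap.enum_fset (fset_set F)); first exact: finmap.fset_uniq.
have f0 : forall k, [set: T] k -> (0 <= (normc (f k))%:E)%E.
  by move=> k _; rewrite lee_fin normc_ge0.
have := @esumID R T F setT _ f0.
rewrite setTI (@esum_fset _ _ F)//; last by move=> k _; exact: f0.
rewrite -[esum setT _]/(l1 f).
have -> : (\esum_(i in [set: T] `&` ~` F) (normc (f i))%:E)%E =
    l1 (fun k => if k \in finmap.enum_fset (fset_set F) then 0 else f k).
  rewrite esum_mkcondr; apply: eq_esum => k _.
  rewrite in_fset_set// in_setC; case: ifP; case: ifP => // _ _.
  by rewrite normc0.
set g := fun k : T => if _ then _ else _; rewrite fsumEFin// => E.
have sg : csummable g.
  by apply: le_csummable sf => k; rewrite /g; case: ifP; rewrite ?normc0 ?normc_ge0.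
move: ltF E; rewrite fsumEFin// (csummableE sf) (csummableE sg) -EFinB -EFinD.
by rewrite lte_fin lee_fin => ltF [E]; move: ltF; rewrite E; lra.
Qed.

Lemma csum_split (f : T -> R[i]) (s : seq T) : csummable f -> uniq s ->
  csum setT f = \sum_(k <- s) f k + csum setT (fun k => if k \in s then 0 else f k).
Proof.
move=> sf us; rewrite -csum_seq// -csumD.
- by congr csum; apply/funext => k; case: ifP; rewrite ?addr0 ?add0r.
- exact: csummable_fin.
- by apply: le_csummable sf => k; case: ifP; rewrite ?normc0 ?normc_ge0.
Qed.

Lemma csum_mkcond D f : csum D f = csum setT (fun k => if k \in D then f k else 0).
Proof.
rewrite /csum /rsum; congr (_ +i* _); congr (fine (_ - _));
  rewrite esum_mkcond; apply: eq_esum => k _;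
  rewrite ?funeposE ?funenegE /=; case: ifP => //= _.
all: by rewrite ?oppe0 ?maxxx ?oppr0 ?maxxx.
Qed.

End OneType.

(** The bridge from unconditional sums to limits of partial sums, by which the exponential,
    trigonometric and logarithmic series are evaluated. *)
Lemma csum_nat (f : nat -> R[i]) s : csummable f ->
  (forall e : R, 0 < e -> exists N, forall n, (N <= n)%N ->
     normc (\sum_(i < n) f i - s) <= e) ->
  csum setT f = s.
Proof.
move=> sf H; apply/eqP; rewrite -subr_eq0; apply/eqP/eq0_normc/eqP.
rewrite eq_le normc_ge0 andbT; apply/ler_addgt0Pl => e e0; rewrite addr0.
have e20 : 0 < e / 2 by lra.
have [N HN] := H _ e20; have [s0 us0 Hs0] := csummable_tail sf e20.
(* The cutoff must be past [N] and also leave every index of [s0] below it, hence the successor. *)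
pose M := maxn N (\max_(k <- s0) k).+1.
have s0M k : k \in s0 -> k \in index_iota 0 M.
  move=> ks0; rewrite mem_index_iota leq0n/= leq_max ltnS.
  by rewrite (@leq_bigmax_seq _ _ _ id)// orbT.
rewrite (csum_split (s := index_iota 0 M)) ?iota_uniq// addrAC.
rewrite (le_trans (normc_triangle _ _))// [e]splitr lerD//.
  by rewrite big_mkord HN// leq_maxl.
apply: normc_csum; apply: le_trans Hs0; apply: le_l1 => k.
case: ifPn => [_|kM]; first by rewrite normc0 normc_ge0.
by case: ifPn => // /s0M ks0; rewrite ks0 in kM.
Qed.

Lemma reindex_csum (T T' : choiceType) (e : T -> T') (f : T' -> R[i]) :
  bijective e -> csum setT f = csum setT (f \o e).
Proof.
move=> be; rewrite /csum (reindex_rsum _ be).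
by rewrite (reindex_rsum (fun k => complex.Im (f k)) be).
Qed.

Lemma reindex_l1 (T T' : choiceType) (e : T -> T') (f : T' -> R[i]) :
  bijective e -> l1 f = l1 (f \o e).
Proof.
rewrite -setTT_bijective => be; exact: (reindex_esum [set: T] [set: T'] e).
Qed.

Section Fubini.
Context {T1 T2 : choiceType}.
Variable f : T1 * T2 -> R[i].

Lemma l1_pair :
  l1 f = (\esum_(i in [set: T1]) l1 (fun j => f (i, j)))%E.
Proof.
rewrite (@esum_esum R T1 T2 setT (fun=> setT) (fun i j => (normc (f (i, j)))%:E)).
  rewrite (_ : _ `*`` _ = [set: T1 * T2]); last by apply/seteqP; split.
  by apply: eq_esum => -[].
by move=> i j _ _; rewrite lee_fin normc_ge0.
Qed.

Hypothesis sf : csummable f.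

Lemma csummable_inner i : csummable (fun j => f (i, j)).
Proof.
apply: le_lt_trans sf; rewrite l1_pair; apply: esum_ge.
by exists [set i]; [split|rewrite fsbig_set1].
Qed.

Lemma le_l1_csum : (l1 (fun i => csum setT (fun j => f (i, j))) <= l1 f)%E.
Proof.
rewrite l1_pair; apply: le_esum => i _.
by rewrite (csummableE (csummable_inner i)) lee_fin normc_csum// -csummableE//;
  exact: csummable_inner.
Qed.

Lemma fubini_csum : csum setT f = csum setT (fun i => csum setT (fun j => f (i, j))).
Proof.
rewrite /csum; congr (_ +i* _).
  by rewrite (fubini_rsum (csummable_Re sf)).2.
by rewrite (fubini_rsum (csummable_Im sf)).2.
Qed.

End Fubini.

Lemma l1_swap (T1 T2 : choiceType) (f : T1 * T2 -> R[i]) :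
  l1 (fun k => f (k.2, k.1)) = l1 f.
Proof.
by rewrite (@reindex_l1 _ _ (fun k => (k.2, k.1)) f)//;
  exists (fun k => (k.2, k.1)) => -[].
Qed.

Lemma csum_swap (T1 T2 : choiceType) (f : T1 * T2 -> R[i]) : csummable f ->
  csum setT (fun i => csum setT (fun j => f (i, j))) =
  csum setT (fun j => csum setT (fun i => f (i, j))).
Proof.
move=> sf; rewrite -fubini_csum//.
rewrite (@reindex_csum _ _ (fun k => (k.2, k.1)) f); last first.
  by exists (fun k => (k.2, k.1)) => -[].
by rewrite fubini_csum// /csummable l1_swap.
Qed.

End ComplexSums.

(** * Characters and iterated integrals *)

Section Characters.
Context {R : realType}.

Definition cis (a : R) : R[i] := cos a +i* sin a.

Lemma cisD a b : cis (a + b) = cis a * cis b.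
Proof. by apply: complexP; rewrite ?cReM ?cImM /= ?cosD ?sinD; ring. Qed.

Lemma cis0 : cis 0 = 1.
Proof. by rewrite /cis cos0 sin0. Qed.

Lemma normc_cis a : normc (cis a) = 1.
Proof. by rewrite /= cos2Dsin2 sqrtr1. Qed.

Lemma cis_neq0 a : cis a != 0.
Proof.
apply/eqP => /(congr1 (@normc R)); rewrite normc_cis normc0 => /eqP.
by rewrite oner_eq0.
Qed.

Lemma cisN a : cis (- a) = (cis a)^-1.
Proof.
apply: (mulfI (cis_neq0 a)); rewrite -cisD subrr cis0.
by rewrite divff// cis_neq0.
Qed.

Lemma cisX a n : cis a ^+ n = cis (n%:R * a).
Proof.
elim: n => [|n IH]; first by rewrite mul0r cis0.
by rewrite exprS IH -cisD -natr1; congr cis; ring.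
Qed.

Lemma cisXz a (m : int) : cis a ^ m = cis (m%:~R * a).
Proof.
case: m => n; first by rewrite -exprnP cisX.
by rewrite NegzE -exprnN cisX -cisN -mulNr rmorphN.
Qed.

Lemma cis_2pi (m : int) : cis (m%:~R * (2 * pi)) = 1.
Proof.
rewrite -cisXz (_ : cis (2 * pi) = 1) ?exp1rz//.
have := cosD2pi (0 : R); have := sinD2pi (0 : R).
by rewrite !add0r cos0 sin0 -[pi *+ 2]mulr_natl /cis => -> ->.
Qed.

Definition phase d (k : 'rV[int]_d) (t : 'rV[R]_d) : R :=
  \sum_i (k 0 i)%:~R * (2 * pi * t 0 i).

(** Working in the angles [t] turns inversion on the torus into [- t], and integer vectors into
    periods. *)
Definition echar d (k : 'rV[int]_d) (t : 'rV[R]_d) : R[i] :=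
  monomial k (torus_pt t).

Section Dim.
Context {d : nat}.
Implicit Types (k l : 'rV[int]_d) (t : 'rV[R]_d).

Lemma torus_ptE t i : torus_pt t 0 i = cis (2 * pi * t 0 i).
Proof. by rewrite mxE /cexp /= expR0 mul1r. Qed.

Lemma echarE k t : echar k t = cis (phase k t).
Proof.
rewrite /echar /monomial /phase (big_morph cis cisD cis0).
by apply: eq_bigr => i _; rewrite torus_ptE cisXz.
Qed.

Lemma torus_torus_pt t : torus (torus_pt t).
Proof.
move=> i; rewrite torus_ptE.
exact: (congr1 (real_complex R) (normc_cis (2 * pi * t 0 i))).
Qed.

Lemma vinv_torus_pt t : vinv (torus_pt t) = torus_pt (- t).
Proof.
apply/rowP => i; rewrite torus_ptE !mxE -[cexp _]/(_ * cis _) /= expR0 mul1r.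
by rewrite -cisN mulrN.
Qed.

Lemma phaseD k l t : phase (k + l) t = phase k t + phase l t.
Proof.
rewrite /phase -big_split /=; apply: eq_bigr => i _.
by rewrite mxE rmorphD mulrDl.
Qed.

Lemma phaseN k t : phase (- k) t = - phase k t.
Proof.
by rewrite /phase -sumrN; apply: eq_bigr => i _; rewrite mxE rmorphN mulNr.
Qed.

Lemma phaseNr k t : phase k (- t) = - phase k t.
Proof.
by rewrite /phase -sumrN; apply: eq_bigr => i _; rewrite mxE !mulrN.
Qed.

Lemma echarD k l t : echar (k + l) t = echar k t * echar l t.
Proof. by rewrite !echarE phaseD cisD. Qed.

Lemma echar0 t : echar 0 t = 1.
Proof. by rewrite echarE /phase big1 ?cis0// => i _; rewrite mxE mul0r. Qed.

Lemma echarN k t : echar (- k) t = echar k (- t).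
Proof. by rewrite !echarE phaseN phaseNr. Qed.

Lemma normc_echar k t : normc (echar k t) = 1.
Proof. by rewrite echarE normc_cis. Qed.

Lemma torus_pt_periodic t (m : 'rV[int]_d) :
  torus_pt (t + map_mx intr m) = torus_pt t.
Proof.
apply/rowP => i; rewrite !torus_ptE !mxE mulrDr cisD.
by rewrite [2 * pi * _%:~R]mulrC cis_2pi mulr1.
Qed.

Lemma continuous_phase k : continuous (phase k).
Proof.
apply: continuous_big => [|i _ t]; first exact: add_continuous.
apply: (@continuous_comp _ _ _ (fun x : 'rV[R]_d => x 0 i)
  (fun y => (k 0 i)%:~R * (2 * pi * y))); first exact: coord_continuous.
by apply: cvgMl_tmp; apply: cvgMl_tmp; exact: cvg_id.
Qed.

End Dim.
End Characters.

Section UnitIntegral.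
Context {R : realType}.
Implicit Types F G : R -> R.

Definition unit_integral F : R := \int[lebesgue_measure]_(t in `[0, 1]%classic) F t.

Lemma unit_integrable F : continuous F ->
  lebesgue_measure.-integrable `[0, 1]%classic (EFin \o F).
Proof.
move=> cF; apply: continuous_compact_integrable; first exact: segment_compact.
exact: continuous_subspaceT.
Qed.

Lemma unit_integralD F G : continuous F -> continuous G ->
  unit_integral (fun t => F t + G t) = unit_integral F + unit_integral G.
Proof. by move=> cF cG; apply: RintegralD => //; exact: unit_integrable. Qed.

Lemma unit_integralZ c F : continuous F ->
  unit_integral (fun t => c * F t) = c * unit_integral F.
Proof. by move=> cF; apply: RintegralZl => //; exact: unit_integrable. Qed.

Lemma unit_integral_le F e : continuous F -> (forall t, `|F t| <= e) ->
  `|unit_integral F| <= e.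
Proof.
move=> cF Fe; apply: le_trans (le_normr_Rintegral _ (unit_integrable cF)) _ => //.
apply: (@le_trans _ _ (\int[lebesgue_measure]_(t in `[0, 1]%classic) e)).
  apply: le_Rintegral => //.
  - apply: unit_integrable => t; apply: continuous_comp; first exact: cF.
    exact: norm_continuous.
  - by apply: unit_integrable => t; exact: cst_continuous.
rewrite Rintegral_cst//= lebesgue_measure_itv/= lte01 oppr0 adde0.
by rewrite mulr1.
Qed.

Lemma unit_integral_trig (a b : R) (m : int) :
  unit_integral (fun t => a * cos (m%:~R * (2 * pi * t)) +
    b * sin (m%:~R * (2 * pi * t))) = if m == 0 then a else 0.
Proof.
case: eqVneq => [->|m0].
  rewrite /unit_integral.
  under eq_Rintegral do rewrite mul0r cos0 sin0 mulr1 mulr0 addr0.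
  by rewrite Rintegral_cst//= lebesgue_measure_itv/= lte01 oppr0 adde0 mulr1.
pose w : R := m%:~R * (2 * pi).
have w0 : w != 0.
  by rewrite /w mulf_neq0 ?intr_eq0// mulf_neq0 ?pnatr_eq0// gt_eqF// pi_gt0.
(* An antiderivative of the integrand. It takes equal values at 0 and 1 because [w] is a nonzero
   integer multiple of 2 pi. *)
pose F t := a / w * sin (w * t) + - (b / w) * cos (w * t).
pose f t := a * cos (w * t) + b * sin (w * t).
have dF (t : R) : is_derive t (1 : R) F (f t).
  rewrite /F /f.
  have dw : is_derive t (1 : R) (fun t => w * t) w.
    by apply: is_derive_eq; rewrite /GRing.scale /= ?mulr1 ?mulr0 ?addr0.
  have ds := is_derive1_comp (is_derive_sin (w * t)) dw.
  have dc := is_derive1_comp (is_derive_cos (w * t)) dw.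
  have H := is_deriveD (is_deriveZ (a / w) ds) (is_deriveZ (- (b / w)) dc).
  apply: (is_derive_eq H); rewrite /GRing.scale /=; field.
  exact: w0.
have derF (t : R) : derivable F t 1 by case: (dF t).
have cF : continuous F.
  by move=> t; apply: differentiable_continuous; exact/derivable1_diffP.
have cf : continuous f.
  have cw : continuous (fun t => w * t) by move=> t; apply: cvgMl_tmp; exact: cvg_id.
  move=> t; apply: cvgD; apply: cvgMl_tmp.
    by apply: (continuous_comp (cw t)); exact: continuous_cos.
  by apply: (continuous_comp (cw t)); exact: continuous_sin.
have -> : (fun t => a * cos (m%:~R * (2 * pi * t)) + b * sin (m%:~R * (2 * pi * t)))
  = f by apply/funext => t; rewrite /f /w mulrA.
rewrite /unit_integral /Rintegral (@continuous_FTC2 _ f F)//.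
- rewrite -EFinB /F mulr1 mulr0 cos0 sin0 /=.
  have -> : cos w = 1 := congr1 (@complex.Re R) (cis_2pi m).
  have -> : sin w = 0 := congr1 (@complex.Im R) (cis_2pi m).
  by ring.
- exact: continuous_subspaceT.
- split; [by move=> t _; exact: derF| |].
  + by apply: cvg_at_right_filter; exact: cF.
  + by apply: cvg_at_left_filter; exact: cF.
- by move=> t _; rewrite derive1E (@derive_val _ _ _ _ _ _ _ (dF t)).
Qed.

End UnitIntegral.

Lemma continuous_unif_limit (R : realType) (T : topologicalType) (f : T -> R) :
  (forall e : R, 0 < e -> exists2 g : T -> R, continuous g &
     forall x, `|f x - g x| <= e) -> continuous f.
Proof.
move=> H x; apply/cvgrPdist_le => e e0.
have e3 : 0 < e / 3 by lra.
have [g cg fg] := H _ e3.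
have /cvgrPdist_le/(_ _ e3) := cg x.
apply: filterS => y gxy.
rewrite (_ : f x - f y = (f x - g x) + (g x - g y) - (f y - g y)); last by ring.
rewrite (le_trans (ler_normB _ _))// (_ : e = e / 3 + e / 3 + e / 3); last by field.
by rewrite lerD// (le_trans (ler_normD _ _))// lerD.
Qed.

Section CubeIntegral.
Context {R : realType}.

Definition slice d (f : 'rV[R]_d.+1 -> R) (t : R) : 'rV[R]_d -> R :=
  fun s => f (row_mx (t%:M : 'rV[R]_1) s).

(* The functions for which every iterated integral in [cube_integral] has a
   continuous integrand. *)
Fixpoint iter_continuous (d : nat) : ('rV[R]_d -> R) -> Prop :=
  match d with
  | 0 => fun f => True
  | d'.+1 => fun f => (forall t, @iter_continuous d' (slice f t)) /\
      continuous (fun t => cube_integral (slice f t))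
  end.

Lemma cube_integralS d (f : 'rV[R]_d.+1 -> R) :
  cube_integral f = unit_integral (fun t => cube_integral (slice f t)).
Proof. by []. Qed.

Lemma iter_continuousD d (f g : 'rV[R]_d -> R) :
  iter_continuous f -> iter_continuous g ->
  iter_continuous (fun x => f x + g x) /\
  cube_integral (fun x => f x + g x) = cube_integral f + cube_integral g.
Proof.
elim: d f g => [//|d IH] f g [f1 f2] [g1 g2].
have E : (fun t => cube_integral (slice (fun x => f x + g x) t)) =
    (fun t => cube_integral (slice f t) + cube_integral (slice g t)).
  by apply/funext => t; rewrite -(IH _ _ (f1 t) (g1 t)).2.
split; last by rewrite !cube_integralS E unit_integralD.
split; first by move=> t; exact: (IH _ _ (f1 t) (g1 t)).1.
by rewrite E => t; apply: cvgD; [exact: f2|exact: g2].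
Qed.

Lemma iter_continuousZ d c (f : 'rV[R]_d -> R) : iter_continuous f ->
  iter_continuous (fun x => c * f x) /\
  cube_integral (fun x => c * f x) = c * cube_integral f.
Proof.
elim: d f => [//|d IH] f [f1 f2].
have E : (fun t => cube_integral (slice (fun x => c * f x) t)) =
    (fun t => c * cube_integral (slice f t)).
  by apply/funext => t; rewrite -(IH _ (f1 t)).2.
split; last by rewrite !cube_integralS E unit_integralZ.
split; first by move=> t; exact: (IH _ (f1 t)).1.
by rewrite E => t; apply: cvgMl_tmp; exact: f2.
Qed.

Lemma cube_integral_le d (f : 'rV[R]_d -> R) e : iter_continuous f ->
  (forall x, `|f x| <= e) -> `|cube_integral f| <= e.
Proof.
elim: d f => [f _|d IH f [f1 f2] fe]; first exact.
rewrite cube_integralS; apply: unit_integral_le f2 _ => t.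
by apply: IH (f1 t) _ => s; exact: fe.
Qed.

Lemma cube_integralB_le d (f g : 'rV[R]_d -> R) e :
  iter_continuous f -> iter_continuous g ->
  (forall x, `|f x - g x| <= e) -> `|cube_integral f - cube_integral g| <= e.
Proof.
move=> cf cg fg; have [cN EN] := iter_continuousZ (-1) cg.
have [cD ED] := iter_continuousD cf cN.
rewrite -mulN1r -EN -ED; apply: cube_integral_le => // x.
by rewrite mulN1r.
Qed.

(** The cube has measure one, so a uniform error [e] stays at most [e] after any number of
    integrations. Absolutely convergent series thus inherit [iter_continuous] from their finite
    partial sums. *)
Lemma iter_continuous_unif d (f : 'rV[R]_d -> R) :
  (forall e : R, 0 < e -> exists2 g : 'rV[R]_d -> R, iter_continuous g &
     forall x, `|f x - g x| <= e) -> iter_continuous f.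
Proof.
elim: d f => [//|d IH] f H.
have f1 t : iter_continuous (slice f t).
  apply: IH => e e0; have [g [g1 _] fg] := H e e0.
  by exists (slice g t); [exact: g1|move=> s; exact: fg].
split=> //; apply: continuous_unif_limit => e e0; have [g [g1 g2] fg] := H e e0.
exists (fun t => cube_integral (slice g t)) => // t.
by apply: cube_integralB_le (f1 t) (g1 t) _ => s; exact: fg.
Qed.

Lemma phase_row_mx d (k : 'rV[int]_d.+1) (t : R) (s : 'rV[R]_d) :
  phase k (row_mx (t%:M : 'rV[R]_1) s) =
  (k 0 ord0)%:~R * (2 * pi * t) + phase (\row_i k 0 (lift ord0 i)) s.
Proof.
rewrite /phase big_ord_recl; congr (_ * (_ * _) + _).
  transitivity (row_mx (t%:M : 'rV[R]_1) s 0 (lshift d ord0)).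
    by congr (row_mx _ _ _ _); exact: val_inj.
  by rewrite row_mxEl mxE eqxx.
apply: eq_bigr => i _; rewrite mxE; congr (_ * (_ * _)).
transitivity (row_mx (t%:M : 'rV[R]_1) s 0 (rshift 1 i)).
  by congr (row_mx _ _ _ _); exact: val_inj.
by rewrite row_mxEr.
Qed.

(** Fixing the first coordinate rotates the pair of coefficients, by the addition formulas. The
    induction therefore needs arbitrary [a] and [b], not a single cosine or sine. *)
Lemma cube_integral_trig d (k : 'rV[int]_d) (a b : R) :
  let f x := a * cos (phase k x) + b * sin (phase k x) in
  iter_continuous f /\ cube_integral f = if k == 0 then a else 0.
Proof.
elim: d k a b => [k a b f|d IH k a b f].
  split=> //=; rewrite /f /phase big_ord0 cos0 sin0 mulr1 mulr0 addr0.
  by rewrite (_ : k == 0) //; apply/eqP/rowP => -[].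
pose k' : 'rV[int]_d := \row_i k 0 (lift ord0 i).
pose w t : R := (k 0 ord0)%:~R * (2 * pi * t).
have sE t : slice f t = fun s =>
    (a * cos (w t) + b * sin (w t)) * cos (phase k' s) +
    (b * cos (w t) + - a * sin (w t)) * sin (phase k' s).
  by apply/funext => s; rewrite /slice /f phase_row_mx -/k' -/(w t) cosD sinD; ring.
have E : (fun t => cube_integral (slice f t)) = fun t =>
    (if k' == 0 then a else 0) * cos (w t) + (if k' == 0 then b else 0) * sin (w t).
  apply/funext => t; rewrite sE (IH k' _ _).2; case: ifP => // _.
  by rewrite !mul0r addr0.
split.
  split; first by move=> t; rewrite sE; exact: (IH k' _ _).1.
  rewrite E; have cw : continuous w.
    by move=> t; apply: cvgMl_tmp; apply: cvgMl_tmp; exact: cvg_id.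
  move=> t; apply: cvgD; apply: cvgMl_tmp.
    by apply: (continuous_comp (cw t)); exact: continuous_cos.
  by apply: (continuous_comp (cw t)); exact: continuous_sin.
rewrite cube_integralS E unit_integral_trig.
have -> : (k == 0) = (k 0 ord0 == 0) && (k' == 0).
  apply/eqP/andP => [kE|[/eqP k0 /eqP k'0]].
    by split; apply/eqP; [rewrite kE mxE|apply/rowP => i; rewrite mxE kE !mxE].
  apply/rowP => i; rewrite mxE; case: (unliftP ord0 i) => [j ->|->] //.
  by have /rowP/(_ j) := k'0; rewrite !mxE.
by case: eqP => //=.
Qed.

End CubeIntegral.

(** * Absolutely convergent Fourier series *)

Section FourierSeries.
Context {R : realType} {d : nat}.
Implicit Types (a b : 'rV[int]_d -> R[i]) (k l : 'rV[int]_d) (t : 'rV[R]_d).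

Definition wsum a t : R[i] := csum setT (fun k => a k * echar k t).

Lemma csummable_wsum a t : csummable a -> csummable (fun k => a k * echar k t).
Proof. by apply: le_csummable => k; rewrite normcM normc_echar mulr1. Qed.

Lemma l1_wsum a t : l1 (fun k => a k * echar k t) = l1 a.
Proof. by apply: eq_esum => k _; rewrite normcM normc_echar mulr1. Qed.

Lemma wsum_approx a s (e : R) t : csummable a -> uniq s ->
  (l1 (fun k => if k \in s then 0%R else a k) <= e%:E)%E ->
  normc (wsum a t - \sum_(k <- s) a k * echar k t) <= e.
Proof.
move=> sa us sE; rewrite /wsum (csum_split _ us); last exact: csummable_wsum.
rewrite addrAC subrr add0r; apply: normc_csum; apply: le_trans sE.
by apply: le_l1 => k; case: ifP => // _; rewrite normcM normc_echar mulr1.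
Qed.

(** [P] is the real or the imaginary part; additivity and the bound by the modulus are all that the
    argument takes from it. Finite partial sums are integrated exactly and approximate [u]
    uniformly. *)
Lemma cube_integral_part (P : R[i] -> R) (u : 'rV[R]_d -> R[i]) a k :
  {morph P : x y / x + y} -> (forall x, `|P x| <= normc x) ->
  (forall (c : R[i]) l, iter_continuous (fun t => P (c * echar l t)) /\
     cube_integral (fun t => P (c * echar l t)) = if l == 0 then P c else 0) ->
  csummable a -> (forall t, u t = wsum a t) ->
  iter_continuous (fun t => P (u t * echar (- k) t)) /\
  cube_integral (fun t => P (u t * echar (- k) t)) = P (a k).
Proof.
move=> PD Pn Pe sa ua.
have P0 : P 0 = 0.
  by apply/eqP; rewrite -normr_le0 (le_trans (Pn _))// normc0.
pose p (s : seq 'rV[int]_d) t := P (\sum_(l <- s) a l * echar (l - k) t).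
have fin s : iter_continuous (p s) /\
    cube_integral (p s) = \sum_(l <- s) if l == k then P (a l) else 0.
  elim: s => [|l s [IH1 IH2]].
    have [_] := Pe 0 0; rewrite eqxx P0 big_nil /p.
    have -> : (fun t => P (0 * echar 0 t)) =
        (fun t => P (\sum_(l <- [::]) a l * echar (l - k) t)).
      by apply/funext => t; rewrite mul0r big_nil.
    split=> //; have [+ _] := Pe 0 0.
    rewrite (_ : (fun t => _) =
        (fun t => P (\sum_(l <- [::]) a l * echar (l - k) t)))//.
    by apply/funext => t; rewrite mul0r big_nil.
  have [c1 E1] := Pe (a l) (l - k); have [c2 E2] := iter_continuousD c1 IH1.
  have -> : p (l :: s) = fun t => P (a l * echar (l - k) t) + p s t.
    by apply/funext => t; rewrite /p big_cons PD.
  by rewrite E2 E1 IH2 big_cons subr_eq0.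
have close e s : uniq s -> (l1 (fun k => if k \in s then 0%R else a k) <= e%:E)%E ->
    forall t, `|P (u t * echar (- k) t) - p s t| <= e.
  move=> us sE t; have PB x y : P x - P y = P (x - y).
    by apply/eqP; rewrite subr_eq -PD subrK.
  rewrite PB (le_trans (Pn _))// (_ : _ - _ =
    (wsum a t - \sum_(l <- s) a l * echar l t) * echar (- k) t).
    by rewrite normcM normc_echar mulr1 wsum_approx.
  rewrite mulrBl -ua mulr_suml; congr (_ - _); apply: eq_bigr => l _.
  by rewrite echarD mulrA.
have cu : iter_continuous (fun t => P (u t * echar (- k) t)).
  apply: iter_continuous_unif => e e0; have [s us sE] := csummable_tail sa e0.
  by exists (p s); [exact: (fin s).1|exact: close].
split=> //; apply/eqP; rewrite -subr_eq0 -normr_le0; apply/ler_addgt0Pl => e e0.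
have e20 : 0 < e / 2 by lra.
have [s us sE] := csummable_tail sa e20.
rewrite addr0 (_ : _ - _ =
  (cube_integral (fun t => P (u t * echar (- k) t)) - cube_integral (p s)) +
  (cube_integral (p s) - P (a k))); last by ring.
rewrite (le_trans (ler_normD _ _))// [e]splitr lerD//.
  by apply: cube_integralB_le; [exact: cu|exact: (fin s).1|exact: close].
(* If [s] contains [k], the partial sum already integrates to [P (a k)]. Otherwise it integrates to
   0, and [a k] is itself one of the tail terms. *)
rewrite (fin s).2 -big_mkcond /=; have [ks|ks] := boolP (k \in s).
  by rewrite -big_filter filter_pred1_uniq// big_seq1 subrr normr0; lra.
rewrite big_seq_cond big1 ?sub0r ?normrN.
  rewrite (le_trans (Pn _))// -lee_fin; apply: le_trans sE.
  have := normc_le_l1 (fun k => if k \in s then 0 else a k) k.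
  by rewrite (negbTE ks).
by move=> l /andP[ls /eqP lk]; rewrite -lk ls in ks.
Qed.

Lemma cube_integral_Re (u : 'rV[R]_d -> R[i]) a k :
  csummable a -> (forall t, u t = wsum a t) ->
  let h t := complex.Re (u t * echar (- k) t) in
  iter_continuous h /\ cube_integral h = complex.Re (a k).
Proof.
apply: cube_integral_part; [exact: cReD|exact: normr_Re|move=> c l].
have := cube_integral_trig l (complex.Re c) (- complex.Im c).
rewrite (_ : (fun t => _) = fun t => complex.Re (c * echar l t))//.
by apply/funext => t; rewrite echarE cReM /=; ring.
Qed.

Lemma cube_integral_Im (u : 'rV[R]_d -> R[i]) a k :
  csummable a -> (forall t, u t = wsum a t) ->
  let h t := complex.Im (u t * echar (- k) t) in
  iter_continuous h /\ cube_integral h = complex.Im (a k).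
Proof.
apply: cube_integral_part; [exact: cImD|exact: normr_Im|move=> c l].
have := cube_integral_trig l (complex.Im c) (complex.Re c).
rewrite (_ : (fun t => _) = fun t => complex.Im (c * echar l t))//.
by apply/funext => t; rewrite echarE cImM /=; ring.
Qed.

(** All the integrals [fourier_coef] in the definitions of the Lagrange functions are evaluated
    through this identity. *)
Lemma fourier_coefE (u : 'rV[R[i]]_d -> R[i]) a k : csummable a ->
  (forall t, u (torus_pt t) = wsum a t) -> fourier_coef u k = a k.
Proof.
move=> sa ua; apply: complexP => /=.
  exact: (cube_integral_Re k sa ua).2.
exact: (cube_integral_Im k sa ua).2.
Qed.

(** The real and imaginary parts are separate integrals, each at most [r], hence the factor 2.
    Applied to an n-th power of a series, the factor occurs once and leaves the growth rate
    unchanged. *)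
Lemma coef_bound a k (r : R) : csummable a ->
  (forall t, normc (wsum a t) <= r) -> normc (a k) <= 2 * r.
Proof.
move=> sa ar; have [cR ER] := cube_integral_Re k sa (fun=> erefl).
have [cI EI] := cube_integral_Im k sa (fun=> erefl).
have b t : normc (wsum a t * echar (- k) t) <= r.
  by rewrite normcM normc_echar mulr1.
rewrite (complexE (a k)) (le_trans (normc_triangle _ _))// normcM !normcR.
have -> : normc ('i : R[i]) = 1 by rewrite /= expr0n/= add0r expr1n sqrtr1.
rewrite mul1r mulr2n mulrDl mul1r -ER -EI.
by rewrite lerD//; apply: cube_integral_le => // t; apply: le_trans (b t);
  [exact: normr_Re|exact: normr_Im].
Qed.

End FourierSeries.

(** * Algebra operations in W, with control of norms and supports *)

Section WienerAlgebra.
Context {R : realType} {d : nat}.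
Implicit Types (a b : 'rV[int]_d -> R[i]) (k l : 'rV[int]_d) (t : 'rV[R]_d).
Implicit Types (S : set 'rV[int]_d) (u v : 'rV[R]_d -> R[i]) (M N : R).

(* [u] is a function of the angles rather than of the point of the torus, and [M]
   bounds its norm in W. *)
Definition wiener S u M : Prop := exists a,
  [/\ forall k, ~ S k -> a k = 0, (l1 a <= M%:E)%E & forall t, u t = wsum a t].

Lemma wiener_sub S S' u M N : S `<=` S' -> M <= N -> wiener S u M -> wiener S' u N.
Proof.
move=> SS' MN [a [aS aM ua]]; exists a; split=> //.
  by move=> k S'k; apply: aS => Sk; apply: S'k; exact: SS'.
by apply: le_trans aM _; rewrite lee_fin.
Qed.

Lemma wiener_bound S u M t : wiener S u M -> normc (u t) <= M.
Proof. by move=> [a [_ aM ->]]; apply: normc_csum; rewrite l1_wsum. Qed.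

Lemma wiener_ge0 S u M : wiener S u M -> 0 <= M.
Proof. by move=> /(wiener_bound 0); exact/le_trans/normc_ge0. Qed.

Lemma wienerD S u v M N : wiener S u M -> wiener S v N ->
  wiener S (fun t => u t + v t) (M + N).
Proof.
move=> [a [aS aM ua]] [b [bS bN vb]]; exists (fun k => a k + b k); split.
- by move=> k Sk; rewrite aS ?bS ?addr0.
- by rewrite (le_trans (l1D _ _))// EFinD leeD.
- have [sa sb] := (csummable_le aM, csummable_le bN).
  move=> t; rewrite ua vb /wsum -csumD; [|exact: csummable_wsum..].
  by congr csum; apply/funext => k; rewrite mulrDl.
Qed.

Lemma wienerZ S u M (c : R[i]) : wiener S u M ->
  wiener S (fun t => c * u t) (normc c * M).
Proof.
move=> [a [aS aM ua]]; exists (fun k => c * a k); split.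
- by move=> k Sk; rewrite aS ?mulr0.
- by rewrite l1Z EFinM lee_wpmul2l// lee_fin normc_ge0.
- move=> t; rewrite ua /wsum -csumZ; last exact/csummable_wsum/csummable_le/aM.
  by congr csum; apply/funext => k; rewrite mulrA.
Qed.

Lemma wiener_echar S k : S k -> wiener S (echar k) 1.
Proof.
move=> Sk; exists (fun l => if l == k then 1 else 0); split.
- by move=> l Sl; case: eqP => // lk; rewrite lk in Sl.
- rewrite /l1 (_ : (fun l => _) = fun l => if l \in [set k] then 1%:E else 0%E).
    by rewrite -esum_mkcond esum_set1.
  by apply/funext => l; rewrite in_set1; case: eqP; rewrite ?normc0 ?normc1.
- move=> t; rewrite /wsum -[LHS](csum_delta k); congr csum; apply/funext => l.
  by case: eqP => [->|]; rewrite ?mul1r ?mul0r.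
Qed.

Lemma wiener_cst S (c : R[i]) : S 0 -> wiener S (fun=> c) (normc c).
Proof.
move=> /wiener_echar /(wienerZ c); rewrite mulr1.
by under eq_fun do rewrite echar0 mulr1.
Qed.

Lemma l1_mul (T1 T2 : choiceType) (f : T1 -> R[i]) (g : T2 -> R[i]) M N :
  (l1 f <= M%:E)%E -> (l1 g <= N%:E)%E ->
  (l1 (fun p : T1 * T2 => f p.1 * g p.2)%R <= (M * N)%:E)%E.
Proof.
move=> fM gN; have sg := csummable_le gN; rewrite l1_pair /=.
under eq_esum do rewrite l1Z (csummableE sg) -EFinM mulrC.
have g0 : 0 <= fine (l1 g) by rewrite fine_ge0// l1_ge0.
rewrite esumZ// => [|k]; last exact: normc_ge0.
rewrite mulrC EFinM -csummableE//; apply: lee_pmul => //; exact: l1_ge0.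
Qed.

(** The coefficients of a product are a convolution. Separate support sets for the two factors and
    the product cover growing boxes as well as a half-space lattice, which is closed under
    addition. *)
Lemma wienerM S1 S2 S u v M N : (forall k l, S1 k -> S2 l -> S (k + l)) ->
  wiener S1 u M -> wiener S2 v N -> wiener S (fun t => u t * v t) (M * N).
Proof.
move=> S12 [a [aS aM ua]] [b [bS bN vb]].
have [sa sb] := (csummable_le aM, csummable_le bN).
(* This bijection sends (m, k) to (k, m - k), so that summing over k for fixed m gives the m-th
   convolution coefficient. *)
pose e (p : 'rV[int]_d * 'rV[int]_d) := (p.2, p.1 - p.2).
have be : bijective e.
  exists (fun p => (p.1 + p.2, p.1)) => -[m k]; rewrite /e /=.
    by rewrite addrC subrK.
  by rewrite addrAC subrr add0r.
pose g (p : 'rV[int]_d * 'rV[int]_d) := a p.2 * b (p.1 - p.2).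
have gN : (l1 g <= (M * N)%:E)%E.
  by rewrite -(reindex_l1 (fun p => a p.1 * b p.2) be) l1_mul.
have sg := csummable_le gN.
exists (fun m => csum setT (fun k => g (m, k))); split.
- move=> m Sm; rewrite -[RHS](@csum0 _ 'rV[int]_d); congr csum; apply/funext => k.
  rewrite /g /=; have [Sk|Sk] := pselect (S1 k); last by rewrite aS// mul0r.
  rewrite bS ?mulr0// => Smk; apply: Sm; have := S12 _ _ Sk Smk.
  by rewrite addrC subrK.
- exact: le_trans (le_l1_csum sg) gN.
move=> t; rewrite ua vb {1}/wsum.
pose F (p : 'rV[int]_d * 'rV[int]_d) := (a p.1 * echar p.1 t) * (b p.2 * echar p.2 t).
have sF : csummable F.
  have := @l1_mul _ _ (fun k => a k * echar k t) (fun k => b k * echar k t) M N.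
  by rewrite !l1_wsum => /(_ aM bN); exact: csummable_le.
have GE : F \o e = fun p => g p * echar p.1 t.
  apply/funext => -[m k]; rewrite /F /g /e /=.
  have -> : echar m t = echar (m - k) t * echar k t by rewrite -echarD subrK.
  by ring.
transitivity (csum setT F).
  rewrite fubini_csum//= mulrC -csumZ; last exact: csummable_wsum.
  congr csum; apply/funext => k; rewrite mulrC -csumZ//; exact: csummable_wsum.
have sG : csummable (fun p => g p * echar p.1 t).
  by rewrite -GE /csummable -(reindex_l1 _ be).
rewrite (reindex_csum _ be) GE fubini_csum//; congr csum; apply/funext => m /=.
rewrite mulrC -csumZ; last exact: csummable_inner.
by congr csum; apply/funext => k; rewrite mulrC.
Qed.

Lemma wienerX S u M n : S 0 -> (forall k l, S k -> S l -> S (k + l)) ->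
  wiener S u M -> wiener S (fun t => u t ^+ n) (M ^+ n).
Proof.
move=> S0 SD uM; elim: n => [|n IH].
  by have := wiener_cst 1 S0; rewrite normc1.
rewrite exprS; under eq_fun do rewrite exprS.
exact: wienerM SD uM IH.
Qed.

(** Completeness of W: the coefficients of the sum are the sums of the coefficients, by exchanging
    two absolutely convergent summations. *)
Lemma wiener_csum S (u : nat -> 'rV[R]_d -> R[i]) (M : nat -> R) (N : R) :
  (forall n, wiener S (u n) (M n)) -> (\esum_(n in [set: nat]) (M n)%:E <= N%:E)%E ->
  wiener S (fun t => csum setT (fun n => u n t)) N.
Proof.
move=> /choice[a aP] MN.
have aS n k : ~ S k -> a n k = 0 by have [+ _ _] := aP n; exact.
have aM n : (l1 (a n) <= (M n)%:E)%E by have [] := aP n.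
have ua n t : u n t = wsum (a n) t by have [] := aP n.
pose f (p : nat * 'rV[int]_d) := a p.1 p.2.
have fN : (l1 f <= N%:E)%E.
  by rewrite l1_pair; apply: le_trans MN; apply: le_esum => n _; exact: aM.
pose g (p : 'rV[int]_d * nat) := f (p.2, p.1).
have gN : (l1 g <= N%:E)%E by rewrite l1_swap.
have sg := csummable_le gN.
exists (fun k => csum setT (fun n => g (k, n))); split.
- move=> k Sk; rewrite -[RHS](@csum0 _ nat); congr csum; apply/funext => n.
  exact: aS.
- exact: le_trans (le_l1_csum sg) gN.
move=> t; pose F (p : nat * 'rV[int]_d) := f p * echar p.2 t.
have sF : csummable F.
  by apply: le_csummable (csummable_le fN) => p; rewrite normcM normc_echar mulr1.
transitivity (csum setT (fun n => csum setT (fun k => F (n, k)))).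
  by congr csum; apply/funext => n; exact: ua.
rewrite csum_swap//; congr csum; apply/funext => k.
rewrite mulrC -csumZ; last exact: csummable_inner.
by congr csum; apply/funext => n; rewrite mulrC.
Qed.

Lemma wiener_sum S (I : Type) (s : seq I) (u : I -> 'rV[R]_d -> R[i]) (M : I -> R) :
  S 0 -> (forall i, wiener S (u i) (M i)) ->
  wiener S (fun t => \sum_(i <- s) u i t) (\sum_(i <- s) M i).
Proof.
move=> S0 uM; elim: s => [|i s IH].
  rewrite big_nil; under eq_fun do rewrite big_nil.
  by have := wiener_cst 0 S0; rewrite normc0.
by rewrite big_cons; under eq_fun do rewrite big_cons; exact: wienerD.
Qed.

End WienerAlgebra.

(** * The exponential of an absolutely convergent Fourier series *)

Section PowerSeries.
Context {R : realType}.

Lemma esum_nat_le (a : nat -> R) (s : R) : (forall n, 0 <= a n) ->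
  (forall n, \sum_(i < n) a i <= s) -> (\esum_(n in [set: nat]) (a n)%:E <= s%:E)%E.
Proof.
move=> a0 H; rewrite -nneseries_esumT => [|n]; last by rewrite lee_fin.
apply: lime_le; first by apply: is_cvg_nneseries => n _ _; rewrite lee_fin.
by apply: nearW => n; rewrite sumEFin big_mkord lee_fin.
Qed.

Lemma sum_exp_le (x : R) n : 0 <= x -> \sum_(i < n) x ^+ i / i`!%:R <= expR x.
Proof.
move=> x0; rewrite -(big_mkord xpredT (fun i => x ^+ i / i`!%:R)) /expR.
apply: (@nondecreasing_cvgn_le _ (series (exp_coeff x)) _
  (is_cvg_series_exp_coeff x) n).
by apply: nondecreasing_series => i _ _; exact: exp_coeff_ge0.
Qed.

Lemma sum_geometric_le (q : R) n : 0 <= q -> q < 1 ->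
  \sum_(i < n) q ^+ i <= (1 - q)^-1.
Proof.
move=> q0 q1; have q10 : 0 < 1 - q by lra.
rewrite -[leRHS]mul1r ler_pdivlMr// mulrC.
have := subrX1 q n; rewrite -opprB => /(canRL (@opprK _)).
by rewrite -mulNr !opprB => <-; rewrite gerBl exprn_ge0.
Qed.

Lemma cexpD (x y : R[i]) : cexp (x + y) = cexp x * cexp y.
Proof.
case: x y => [a b] [c e]; rewrite /cexp /= expRD -!/(cis _) cisD rmorphM.
by ring.
Qed.

Lemma cexp_real (x : R) : cexp x%:C = (expR x)%:C.
Proof. by rewrite /cexp /= -/(cis 0) cis0 mulr1. Qed.

Definition exp_term (z : R[i]) n : R[i] := (n`!%:R)^-1 * z ^+ n.

Lemma normc_nat n : normc (n%:R : R[i]) = n%:R.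
Proof. by rewrite -(rmorph_nat (real_complex R)) normcR normr_nat. Qed.

Lemma normc_exp_term z n : normc (exp_term z n) = normc z ^+ n / n`!%:R.
Proof. by rewrite /exp_term normcM normcV normc_nat normc_exp mulrC. Qed.

Lemma l1_exp_term z : (l1 (exp_term z) <= (expR (normc z))%:E)%E.
Proof.
apply: esum_nat_le => n; first exact: normc_ge0.
under eq_bigr do rewrite normc_exp_term.
by apply: sum_exp_le; exact: normc_ge0.
Qed.

Lemma csum_nat_cvg (f : nat -> R[i]) (a b : R) : csummable f ->
  (fun n => \sum_(i < n) complex.Re (f i)) @ \oo --> a ->
  (fun n => \sum_(i < n) complex.Im (f i)) @ \oo --> b ->
  csum setT f = a +i* b.
Proof.
move=> sf /cvgrPdist_le fa /cvgrPdist_le fb; apply: csum_nat => // e e0.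
have e20 : 0 < e / 2 by lra.
have [N1 _ H1] := fa _ e20; have [N2 _ H2] := fb _ e20.
exists (maxn N1 N2) => n; rewrite geq_max => /andP[n1 n2].
rewrite [X in normc X](_ : _ = (\sum_(i < n) complex.Re (f i) - a)%:C +
    'i * (\sum_(i < n) complex.Im (f i) - b)%:C).
  rewrite (le_trans (normc_triangle _ _))// normcM !normcR.
  have -> : normc ('i : R[i]) = 1 by rewrite /= expr0n/= add0r expr1n sqrtr1.
  by rewrite mul1r [e]splitr lerD// distrC; [exact: H1|exact: H2].
rewrite [LHS]complexE; congr (_%:C + 'i * _%:C).
  rewrite -[_ - _]/(_ + - _) cReD /=; congr (_ - _).
  by rewrite (big_morph (@complex.Re R) (@cReD R) (erefl _)).
rewrite -[_ - _]/(_ + - _) cImD /=; congr (_ - _).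
by rewrite (big_morph (@complex.Im R) (@cImD R) (erefl _)).
Qed.

Lemma csum_exp_real (x : R) : csum setT (exp_term x%:C) = (expR x)%:C.
Proof.
have E i : exp_term x%:C i = (exp_coeff x i)%:C.
  rewrite /exp_term /exp_coeff /= rmorphM rmorphXn fmorphV rmorph_nat.
  by rewrite mulrC.
apply: csum_nat_cvg; first exact/csummable_le/l1_exp_term.
  under eq_fun do under eq_bigr do rewrite E.
  under eq_fun do rewrite -(big_mkord xpredT).
  exact: is_cvg_series_exp_coeff.
under eq_fun do under eq_bigr do rewrite E.
by under eq_fun do rewrite big1//; exact: cvg_cst.
Qed.

(** The right-hand side has the shape of [cos_coeff] and [sin_coeff]. For even [n], in particular
    [n = 0], the predecessor is harmless since its factor vanishes. *)
Lemma exprI n : ('i : R[i]) ^+ n =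
  ((~~ odd n)%:R * (-1) ^+ n./2) +i* ((odd n)%:R * (-1) ^+ n.-1./2).
Proof.
elim: n => [|n IH]; first by rewrite /= mul0r mulr1.
rewrite exprS IH; apply: complexP; rewrite ?cReM ?cImM /=; last by ring.
rewrite negbK; case: (boolP (odd n)) => on /=; last by ring.
by case: n on {IH} => // n _; rewrite /= exprS; ring.
Qed.

Lemma csum_exp_imag (y : R) : csum setT (exp_term (y *i)) = cis y.
Proof.
have E n : exp_term (y *i) n = cos_coeff y n +i* sin_coeff y n.
  have -> : y *i = y%:C * 'i by simpc.
  rewrite /exp_term exprMn exprI -(rmorph_nat (real_complex R)) -fmorphV.
  rewrite -rmorphXn mulrA -rmorphM; apply: complexP.
    by rewrite cReM /= mul0r subr0 /cos_coeff /= -[(-1) ^ n./2]/((-1) ^+ n./2); ring.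
  by rewrite cImM /= mul0r addr0 /sin_coeff /=; ring.
apply: csum_nat_cvg; first exact/csummable_le/l1_exp_term.
  under eq_fun do under eq_bigr do rewrite E.
  under eq_fun do rewrite -(big_mkord xpredT).
  by rewrite unlock; exact: is_cvg_series_cos_coeff.
under eq_fun do under eq_bigr do rewrite E.
under eq_fun do rewrite -(big_mkord xpredT).
by rewrite unlock; exact: is_cvg_series_sin_coeff.
Qed.

(** Reindexing along an injection whose image contains the support of [f]. It carries the sum over
    pairs of naturals onto the triangle of a Cauchy product. *)
Lemma csum_inj (T T' : choiceType) (e : T -> T') (f : T' -> R[i]) :
  injective e -> (forall i', (forall i, e i <> i') -> f i' = 0) ->
  csum setT f = csum setT (f \o e) /\ l1 f = l1 (f \o e).
Proof.
move=> ie f0.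
have f0' k : k \notin e @` [set: T] -> f k = 0.
  by rewrite notin_setE => H; apply: f0 => i ik; apply: H; exists i.
have E (a : T' -> \bar R) : (forall k, k \notin e @` [set: T] -> a k = 0%E) ->
    (\esum_(k in [set: T']) a k = \esum_(i in [set: T]) a (e i))%E.
  move=> a0; rewrite -(@esum_image R _ _ setT e); last by move=> ? ? _ _ /ie.
  rewrite [RHS]esum_mkcond; apply: eq_esum => k _.
  by case: ifPn => // /a0.
split; last by apply: E => k /f0' ->; rewrite normc0.
rewrite /csum /rsum; congr (_ +i* _); congr (fine (_ - _)); rewrite E;
  try (by apply: eq_esum => k _; rewrite ?funeposE ?funenegE);
  by move=> k /f0' fk; rewrite ?funeposE ?funenegE /= fk /= ?oppe0 ?oppr0 ?maxxx.
Qed.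

(* Cauchy product of the series of exp(Re z) and exp(i Im z). *)
Lemma csum_exp (z : R[i]) : csum setT (exp_term z) = cexp z.
Proof.
case: z => x y; pose A := exp_term x%:C; pose B := exp_term (y *i).
pose F (p : nat * nat) := A p.1 * B p.2.
have [sA sB] : csummable A /\ csummable B.
  by split; exact/csummable_le/l1_exp_term.
have sF : csummable F.
  have [MA MB] := (csummableE sA, csummableE sB).
  apply: (@csummable_le _ _ _ (fine (l1 A) * fine (l1 B))); apply: l1_mul.
    by rewrite -MA.
  by rewrite -MB.
have -> : cexp (x +i* y) = csum setT F.
  rewrite (fubini_csum sF) /cexp /= -[X in _ * X = _]/(cis y).
  rewrite -csum_exp_real -csum_exp_imag -/A -/B mulrC -(csumZ _ sA).
  congr csum; apply/funext => k; rewrite mulrC; exact: (esym (csumZ (A k) sB)).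
(* The map [e] parametrizes the triangle k <= n by pairs (k, n - k), and [G] extends the terms by
   zero off the triangle, so that rows become binomial sums. *)
pose e (p : nat * nat) := ((p.1 + p.2)%N, p.1).
pose G (p : nat * nat) := if (p.2 <= p.1)%N then A p.2 * B (p.1 - p.2)%N else 0.
have [EG LG] : csum setT G = csum setT (G \o e) /\ l1 G = l1 (G \o e).
  apply: csum_inj => [[a b] [a' b'] [+ aa']|[n k] H].
    by rewrite aa' => /addnI ->.
  rewrite /G /=; case: leqP => // kn; exfalso.
  by apply: (H (k, (n - k)%N)); rewrite /e /= subnKC.
have GE : G \o e = F.
  by apply/funext => -[k l]; rewrite /G /e /= leq_addr addKn.
have sG : csummable G by rewrite /csummable LG GE.
rewrite -GE -EG fubini_csum//; congr csum; apply/funext => n.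
rewrite [RHS](_ : _ = csum setT (fun k =>
  if k \in iota 0 n.+1 then A k * B (n - k)%N else 0)); last first.
  by congr csum; apply/funext => k; rewrite mem_iota add0n ltnS.
rewrite csum_seq ?iota_uniq//.
have -> : iota 0 n.+1 = index_iota 0 n.+1 by rewrite /index_iota subn0.
rewrite big_mkord /exp_term.
have -> : x +i* y = y *i + x%:C by simpc.
rewrite exprDn mulr_sumr; apply: eq_bigr => k _; rewrite /A /B /exp_term.
have kn : (k <= n)%N by rewrite -ltnS.
have := bin_fact kn => /(congr1 (fun m => m%:R : R[i])); rewrite !natrM => <-.
have nz m : (m`!%:R : R[i]) != 0 by rewrite pnatr_eq0 -lt0n fact_gt0.
have bz : ('C(n, k)%:R : R[i]) != 0 by rewrite pnatr_eq0 -lt0n bin_gt0.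
by rewrite -mulr_natl; field; rewrite !nz bz.
Qed.

End PowerSeries.

(** Powers of [u] stay supported on [S] because [S] is closed under addition. The exponential series
    of the norm bound [M] converges whatever its size. *)
Lemma wiener_cexp (R : realType) d (S : set 'rV[int]_d) (u : 'rV[R]_d -> R[i]) M :
  S 0 -> (forall k l, S k -> S l -> S (k + l)) -> wiener S u M ->
  wiener S (fun t => cexp (u t)) (expR M).
Proof.
move=> S0 SD uM; have M0 := wiener_ge0 uM.
under eq_fun do rewrite -csum_exp.
apply: (@wiener_csum _ _ _ _ (fun n => M ^+ n / n`!%:R)) => [n|].
  have := wienerZ ((n`!%:R)^-1) (wienerX n S0 SD uM).
  by rewrite normcV normc_nat mulrC.
apply: esum_nat_le => n; first by rewrite divr_ge0// exprn_ge0.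
exact: sum_exp_le.
Qed.

(** * The logarithm of an absolutely convergent Fourier series *)

Section Boxes.
Context {d : nat}.

Definition box (L : nat) : set 'rV[int]_d :=
  [set k : 'rV[int]_d | forall i, (`|k ord0 i| <= L)%N].

Lemma boxD L L' k l : box L k -> box L' l -> box (L + L')%N (k + l).
Proof.
move=> kL lL i; rewrite mxE -lez_nat PoszD.
by rewrite !abszE (le_trans (ler_normD _ _))// lerD// -abszE lez_nat.
Qed.

Lemma finite_box (s : seq 'rV[int]_d) : exists L, forall k, k \in s -> box L k.
Proof.
exists (\max_(k <- s) \max_i `|k ord0 i|)%N => k ks i.
apply: (@leq_trans (\max_i `|k ord0 i|)%N); first exact: leq_bigmax.
exact: (@leq_bigmax_seq _ _ _ (fun k : 'rV[int]_d => \max_i `|k ord0 i|)%N).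
Qed.

Definition box_seq (L : nat) : seq 'rV[int]_d :=
  [seq \row_i ((f i : nat)%:Z - L%:Z) | f : {ffun 'I_d -> 'I_(L.*2.+1)}].

Lemma size_box_seq L : size (box_seq L) = (L.*2.+1 ^ d)%N.
Proof. by rewrite size_map -cardE card_ffun !card_ord. Qed.

Lemma mem_box_seq L k : box L k -> k \in box_seq L.
Proof.
move=> kL; pose f := [ffun i => inord (absz (k ord0 i + L%:Z)) : 'I_(L.*2.+1)].
apply/fintype.imageP; exists f => //; apply/rowP => i; rewrite mxE ffunE.
have := kL i; rewrite -lez_nat abszE ler_norml => /andP[k1 k2].
have kL0 : 0 <= k ord0 i + L%:Z by rewrite -lerBlDr sub0r.
rewrite inordK; first by rewrite gez0_abs// addrK.
by move: (k ord0 i) k1 k2 kL0 => z k1 k2 kL0; lia.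
Qed.

End Boxes.

Section PowerBound.
Context {R : realType} {d : nat}.
Implicit Types (a b : 'rV[int]_d -> R[i]) (t : 'rV[R]_d).

Lemma l1_seq (T : choiceType) (s : seq T) (f : T -> R[i]) : uniq s ->
  l1 (fun k => if k \in s then f k else 0) = (\sum_(k <- s) normc (f k))%:E.
Proof.
move=> us; rewrite /l1 (_ : (fun k => _) = fun k =>
    if k \in [set` s] then (normc (f k))%:E else 0%E); last first.
  by apply/funext => k; rewrite mem_setE; case: ifP => //; rewrite normc0.
rewrite -esum_mkcond esum_fset => [||k _]; [|exact: finite_seq|]; last first.
  by rewrite lee_fin normc_ge0.
by rewrite -fsbig_seq// sumEFin.
Qed.

Lemma l1_box a L (m : R) : (forall k, ~ box L k -> a k = 0) ->
  (forall k, normc (a k) <= m) -> (l1 a <= ((L.*2.+1 ^ d)%:R * m)%:E)%E.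
Proof.
move=> aL am; pose s := undup (@box_seq d L).
have -> : a = fun k => if k \in s then a k else 0.
  apply/funext => k; case: ifPn => // ks; apply: aL => /mem_box_seq.
  by apply/negP; rewrite mem_undup in ks.
have m0 : 0 <= m by apply: le_trans (am 0); exact: normc_ge0.
rewrite l1_seq ?undup_uniq// lee_fin (@le_trans _ _ (\sum_(k <- s) m))//.
  by apply: ler_sum => k _; exact: am.
rewrite big_const_seq count_predT iter_addr addr0 -[m *+ _]mulr_natl ler_wpM2r// ler_nat.
by rewrite -size_box_seq size_undup.
Qed.

(** Induction on the degree: x is split as y * y, one factor y^m paying for a linear term 2Nm + 1
    and the other for the remaining power. *)
Lemma poly_le_exp (N n : nat) (x : R) : 1 < x ->
  exists2 C : R, 0 <= C & forall m, (((N * m).*2.+1) ^ n)%:R <= C * x ^+ m.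
Proof.
elim: n x => [|n IH] x x1.
  exists 1 => // m; rewrite expn0 mul1r; apply: exprn_ege1; exact: ltW.
pose y := Num.sqrt x.
have xE : x = y * y by rewrite -expr2 sqr_sqrtr//; lra.
have y1 : 1 < y.
  by rewrite -[1](@sqrtr1 R) ltr_sqrt//; lra.
have [C C0 HC] := IH y y1.
(* Chosen so that [C' * (1 + m * (y - 1))] dominates 2Nm + 1; Bernoulli's inequality [bern] then
   passes to y^m. *)
pose C' := 1 + 2 * N%:R / (y - 1).
have y10 : 0 < y - 1 by lra.
have N0 : 0 <= 2 * N%:R / (y - 1) :> R.
  by apply: divr_ge0; [apply: mulr_ge0|exact: ltW].
exists (C' * C) => [|m]; first by rewrite mulr_ge0// /C' addr_ge0.
have bern : 1 + m%:R * (y - 1) <= y ^+ m.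
  elim: m => [|m IHm]; first by rewrite mul0r addr0.
  rewrite exprS -natr1; have y0 : 0 <= y by lra.
  apply: le_trans (ler_wpM2l y0 IHm); rewrite -subr_ge0.
  rewrite (_ : _ - _ = m%:R * (y - 1) ^+ 2); last by ring.
  by rewrite mulr_ge0// sqr_ge0.
have lin : ((N * m).*2.+1)%:R <= C' * y ^+ m.
  have C'0 : 0 <= C' by rewrite addr_ge0.
  apply: (@le_trans _ _ (C' * (1 + m%:R * (y - 1)))); last by rewrite ler_wpM2l.
  rewrite -natr1 -muln2 !natrM.
  have -> : C' * (1 + m%:R * (y - 1)) =
    1 + 2 * N%:R / (y - 1) + m%:R * (y - 1) + 2 * N%:R * m%:R.
    by rewrite /C'; field; lra.
  have m0 : 0 <= m%:R * (y - 1) by apply: mulr_ge0 => //; lra.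
  lra.
rewrite expnS natrM xE exprMn mulrACA ler_pM//.
Qed.

(** The norm is estimated twice. The crude bound by powers of [l1 a] only shows that the n-th power
    is a series supported in a box; counting that box and bounding each coefficient by the supremum
    gives the sharp rate. *)
Lemma wiener_trig_power a L (r : R) n : csummable a ->
  (forall k, ~ box L k -> a k = 0) ->
  (forall t, normc (wsum a t) <= r) ->
  wiener setT (fun t => wsum a t ^+ n) (((L * n).*2.+1 ^ d)%:R * (2 * r ^+ n)).
Proof.
move=> sa aL ar.
have : wiener (box (L * n)) (fun t => wsum a t ^+ n) (fine (l1 a) ^+ n).
  elim: n => [|n IH].
    have := @wiener_cst R d (box (L * 0)) 1; rewrite normc1; apply.
    by move=> i; rewrite mxE.
  rewrite exprS mulnS; under eq_fun do rewrite exprS.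
  apply: wienerM IH; first by move=> k l; exact: boxD.
  by exists a; split=> //; rewrite -csummableE.
move=> [c [cL cM cE]]; exists c; split=> [k []||]//; apply: l1_box => // k.
apply: coef_bound; first exact: csummable_le cM.
move=> t; rewrite -cE normc_exp lerXn2r ?nnegrE ?normc_ge0//.
by apply: le_trans (ar t); exact: normc_ge0.
Qed.

(* Only the sup norm of u enters the growth rate: u is a trigonometric polynomial
   up to a small remainder, and the powers of a trigonometric polynomial have
   polynomially many coefficients, each bounded by the sup norm. *)
Lemma wiener_power_bound (u : 'rV[R]_d -> R[i]) M (r : R) : wiener setT u M ->
  (forall t, normc (u t) <= r) -> r < 1 ->
  exists C q : R, [/\ 0 <= C, 0 <= q, q < 1 &
    forall n, wiener setT (fun t => u t ^+ n) (C * q ^+ n)].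
Proof.
move=> [a [_ aM ua]] ur r1; have sa := csummable_le aM.
have r0 : 0 <= r by apply: le_trans (ur 0); exact: normc_ge0.
(* Three losses of [e] must keep the rate below 1: the polynomial part has supremum at most [r + e],
   the number of coefficients raises the rate to [r + 2 * e] through the ratio [x], and the binomial
   expansion with the remainder gives [r + 3 * e], which is [1 - e]. *)
pose e := (1 - r) / 4; have e0 : 0 < e by rewrite /e; lra.
have [s us sE] := csummable_tail sa e0; have [L HL] := finite_box s.
pose p k := if k \in s then a k else 0.
pose h k := if k \in s then 0 else a k.
have sp : csummable p := csummable_fin s a.
have sh : csummable h := csummable_le sE.
have uE t : u t = wsum p t + wsum h t.
  rewrite ua /wsum -csumD; [|exact: csummable_wsum..]; congr csum.
  by apply/funext => k; rewrite /p /h; case: ifP; rewrite ?mul0r ?addr0 ?add0r.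
have hw : wiener setT (wsum h) e by exists h; split=> // k [].
have pr t : normc (wsum p t) <= r + e.
  have -> : wsum p t = u t - wsum h t by rewrite uE addrK.
  rewrite (le_trans (normc_triangle _ _))// normc_opp lerD//.
  exact: wiener_bound hw.
have pL k : ~ box L k -> p k = 0.
  by move=> kL; rewrite /p; case: ifPn => // /HL.
have re : 0 < r + e by lra.
pose x := (r + 2 * e) / (r + e).
have x1 : 1 < x by rewrite /x ltr_pdivlMr//; lra.
have [C C0 HC] := @poly_le_exp L d x x1.
exists (2 * C), (r + 3 * e); split; [lra|lra|rewrite /e; lra|move=> n].
have pw m : wiener setT (fun t => wsum p t ^+ m) (2 * C * (r + 2 * e) ^+ m).
  apply: wiener_sub (wiener_trig_power m sp pL pr) => //.
  have -> : r + 2 * e = x * (r + e) by rewrite /x mulfVK// gt_eqF.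
  rewrite exprMn (_ : 2 * C * _ = (C * x ^+ m) * (2 * (r + e) ^+ m)); last by ring.
  by rewrite ler_wpM2r// mulr_ge0// exprn_ge0// ltW.
have -> : 2 * C * (r + 3 * e) ^+ n = \sum_(i < n.+1)
    'C(n, i)%:R * (2 * C * (r + 2 * e) ^+ (n - i) * e ^+ i).
  rewrite (_ : r + 3 * e = r + 2 * e + e); last by ring.
  rewrite exprDn mulr_sumr; apply: eq_bigr => i _.
  by rewrite -mulr_natl; ring.
have -> : (fun t => u t ^+ n) = fun t => \sum_(i < n.+1)
    'C(n, i)%:R * (wsum p t ^+ (n - i) * wsum h t ^+ i).
  apply/funext => t; rewrite uE exprDn; apply: eq_bigr => i _.
  by rewrite mulr_natl.
apply: wiener_sum => // i; rewrite -[X in X * _]normc_nat.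
apply: wienerZ; apply: wienerM (pw _) (wienerX i _ _ hw) => //.
Qed.

End PowerBound.

Section Logarithm.
Context {R : realType}.

(** The derivative of the remainder is a geometric tail, y^n / (1 - y), and the remainder vanishes
    at 0, so the mean value theorem on [0, x] bounds it. *)
Lemma ln_series_le (r x : R) n : 0 <= x -> x <= r -> r < 1 ->
  `|- ln (1 - x) - \sum_(i < n) x ^+ i.+1 / i.+1%:R| <= r ^+ n / (1 - r).
Proof.
move=> x0 xr r1.
pose F m y : R := - ln (1 - y) - \sum_(i < m) y ^+ i.+1 / i.+1%:R.
pose f m (y : R) := (1 - y)^-1 - \sum_(i < m) y ^+ i.
have dF m (y : R) : y < 1 -> is_derive y (1 : R) (F m) (f m y).
  move=> y1; elim: m => [|m IH].
    rewrite /F /f; under eq_fun do rewrite big_ord0 subr0.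
    rewrite big_ord0 subr0.
    pose p (z : R) := 1 - z; have y10 : 0 < p y by rewrite /p; lra.
    have d1 : is_derive y (1 : R) p (-1).
      have H := is_deriveB (is_derive_cst (1 : R) y (1 : R)) (is_derive_id y (1 : R)).
      by apply: (is_derive_eq H); rewrite sub0r.
    have H := is_deriveN (@is_derive1_comp _ _ p _ _ _ (is_derive1_ln y10) d1).
    by apply: (is_derive_eq H); rewrite mulrN1 opprK.
  have dX : is_derive y (1 : R) (fun y => (m.+1%:R)^-1 *: y ^+ m.+1) (y ^+ m).
    have dP : is_derive y (1 : R) (fun z : R => z ^+ m.+1) (m.+1%:R *: y ^+ m).
      by apply: DeriveDef; [exact: exprn_derivable|rewrite exp_derive scaler1].
    have H := is_deriveZ ((m.+1%:R)^-1) dP.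
    by apply: (is_derive_eq H); rewrite scalerA mulVf ?scale1r// pnatr_eq0.
  have H := is_deriveB IH dX.
  have -> : F m.+1 = F m - (fun y => (m.+1%:R)^-1 *: y ^+ m.+1).
    apply/funext => z; rewrite /F -[RHS]/(_ - _) big_ord_recr /= opprD addrA.
    by congr (_ - _); rewrite mulrC.
  by apply: (is_derive_eq H); rewrite /f big_ord_recr /= opprD addrA.
have cF m (y : R) : y < 1 -> {for y, continuous (F m)}.
  move=> y1; apply: differentiable_continuous; apply/derivable1_diffP.
  by case: (dF m y y1).
have x1 : x < 1 by lra.
have [|//||c cx] := @MVT_segment R (F n) (f n) 0 x.
- by [].
- by move=> y; rewrite in_itv /= => /andP[_ yx]; apply: dF; lra.
- apply: continuous_in_subspaceT => y; rewrite inE /= in_itv /= => /andP[_ yx].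
  by apply: cF; lra.
have F0 : F n 0 = 0.
  rewrite /F subr0 ln1 oppr0 sub0r big1 ?oppr0// => i _.
  by rewrite expr0n mul0r.
rewrite F0 subr0 -/(F n x) => ->; rewrite subr0.
move: cx; rewrite in_itv /= => /andP[c0 cx].
have fE : f n c = c ^+ n / (1 - c).
  have c1 : 1 - c != 0 by rewrite gt_eqF//; lra.
  apply: (mulIf c1); rewrite mulfVK// /f mulrBl mulVf//.
  have := subrX1 c n; rewrite mulrC => E; rewrite -[1 - c]opprB mulrN -E; ring.
rewrite fE normrM (ger0_norm x0) ger0_norm; last first.
  by rewrite divr_ge0 ?exprn_ge0//; lra.
apply: (@le_trans _ _ (c ^+ n / (1 - c) * 1)).
  rewrite ler_wpM2l//; last by lra.
  by rewrite divr_ge0 ?exprn_ge0//; lra.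
rewrite mulr1 ler_pM ?exprn_ge0// ?invr_ge0 ?lerXn2r ?nnegrE//; try lra.
rewrite lef_pV2 ?posrE; lra.
Qed.

(** Dividing by [M], which also bounds the supremum of [u], puts [g = 1 - u / M] between 0 and
    [1 - c / M]. Then [wiener_power_bound] makes the series of ln(1 - g) converge in W, and adding
    the constant ln M gives back ln u. *)
Lemma wiener_ln d (u : 'rV[R]_d -> R) M (c : R) :
  wiener setT (fun t => (u t)%:C) M -> 0 < c -> (forall t, c <= u t) ->
  exists N, wiener setT (fun t => (ln (u t))%:C) N.
Proof.
move=> uM c0 cu.
have uleM t : u t <= M.
  have := wiener_bound t uM; rewrite normcR; exact/le_trans/ler_norm.
have M0 : 0 < M by apply: lt_le_trans c0 (le_trans (cu 0) (uleM 0)).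
pose r := 1 - c / M; pose g t := 1 - u t / M.
have r1 : r < 1 by rewrite /r ltrBlDr ltrDl divr_gt0.
have g0 t : 0 <= g t by rewrite /g subr_ge0 ler_pdivrMr// mul1r.
have gr t : g t <= r by rewrite /g /r lerD2l lerN2 ler_pM2r ?invr_gt0.
have r0 : 0 <= r := le_trans (g0 0) (gr 0).
have gw : wiener setT (fun t => (g t)%:C) (1 + normc (- (M^-1)%:C) * M).
  have := wienerD (wiener_cst 1 (I : [set: 'rV[int]_d] 0)) (wienerZ (- (M^-1)%:C) uM).
  rewrite normc1 (_ : (fun t => _) = fun t => (g t)%:C)//.
  by apply/funext => t; rewrite /g mulNr -rmorphM -rmorphN -rmorphD mulrC.
have gn t : normc (g t)%:C <= r by rewrite normcR ger0_norm.
have [C [q [C0 q0 q1 Hq]]] := wiener_power_bound gw gn r1.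
have S : wiener setT (fun t => csum setT (fun n : nat =>
    ((n.+1%:R)^-1)%:C * (g t)%:C ^+ n.+1)) (C * (1 - q)^-1).
  apply: (@wiener_csum _ _ _ _ (fun n => normc ((n.+1%:R : R)^-1)%:C * (C * q ^+ n.+1))).
    by move=> n; exact: wienerZ.
  apply: esum_nat_le => n.
    by rewrite mulr_ge0 ?normc_ge0// mulr_ge0// exprn_ge0.
  apply: (@le_trans _ _ (\sum_(i < n) C * q ^+ i)).
    apply: ler_sum => i _; rewrite normcR ger0_norm ?invr_ge0//.
    rewrite -[leRHS]mul1r ler_pM ?invr_ge0// ?mulr_ge0 ?exprn_ge0//.
      by rewrite invf_le1// ler1n.
    by rewrite ler_wpM2l// exprS ler_piMl ?exprn_ge0// ltW.
  by rewrite -mulr_sumr ler_wpM2l// sum_geometric_le.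
have := wienerD (wiener_cst (ln M)%:C (I : [set: 'rV[int]_d] 0)) (wienerZ (-1) S).
set N := (X in wiener _ _ X -> _) => H; exists N; move: H.
congr (wiener _ _ _); apply/funext => t.
rewrite mulN1r.
have -> : csum setT (fun n : nat => ((n.+1%:R)^-1)%:C * (g t)%:C ^+ n.+1)
    = (- ln (1 - g t))%:C.
  apply: csum_nat.
    apply: (@csummable_le _ _ _ (1 - r)^-1); apply: esum_nat_le => n.
      exact: normc_ge0.
    apply: le_trans (sum_geometric_le n r0 r1); apply: ler_sum => i _.
    rewrite normcM normc_exp !normcR !ger0_norm ?invr_ge0//.
    rewrite -[leRHS]mul1r ler_pM ?invr_ge0// ?exprn_ge0//.
      by rewrite invf_le1// ler1n.
    apply: (@le_trans _ _ (g t ^+ i)); last by rewrite lerXn2r ?nnegrE.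
    by rewrite exprS ler_piMl ?exprn_ge0// (le_trans (gr t))// ltW.
  move=> e e0.
  have [n0 Hn0] : exists n0, forall n, (n0 <= n)%N -> r ^+ n / (1 - r) <= e.
    have r10 : 0 < 1 - r by lra.
    have er0 : 0 < e * (1 - r) by rewrite mulr_gt0.
    have := @cvg_expr R r; rewrite ger0_norm// => /(_ r1)/cvgrPdist_le/(_ _ er0).
    move=> [n0 _ H]; exists n0 => n nn0; rewrite ler_pdivrMr//.
    by have := H n nn0; rewrite sub0r normrN ger0_norm// exprn_ge0.
  exists n0 => n /Hn0; apply: le_trans.
  rewrite -normc_opp opprB.
  rewrite (_ : _ - _ = (- ln (1 - g t) - \sum_(i < n) g t ^+ i.+1 / i.+1%:R)%:C).
    by rewrite normcR ln_series_le.
  rewrite [RHS]rmorphB [in RHS]rmorph_sum; congr (_ - _); apply: eq_bigr => i _.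
  by rewrite -rmorphXn -rmorphM mulrC.
rewrite -rmorphN -rmorphD opprK /g subKr; congr (_%:C).
have ut0 : 0 < u t by apply: lt_le_trans (cu t).
by rewrite lnM ?posrE ?invr_gt0// lnV ?posrE//; ring.
Qed.

End Logarithm.

(** * Wiener-Hopf factorization *)

Section SeriesOnTorus.
Context {R : realType} {d : nat}.
Implicit Types (a b : 'rV[int]_d -> R[i]) (k : 'rV[int]_d) (t : 'rV[R]_d).

(** Transfers identities between functions to their coefficients: evenness of the logarithm's
    coefficients, and later the coefficients of the deviation. *)
Lemma wsum_inj a b : csummable a -> csummable b ->
  (forall t, wsum a t = wsum b t) -> a = b.
Proof.
move=> sa sb ab; apply/funext => k.
pose u (z : 'rV[R[i]]_d) := csum setT (fun k => a k * monomial k z).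
by rewrite -(@fourier_coefE _ _ u a k)// (@fourier_coefE _ _ u b k).
Qed.

Lemma wsumN a t : wsum a (- t) = wsum (fun k => a (- k)) t.
Proof.
rewrite /wsum (reindex_csum (e := -%R)); last by exists -%R; exact: opprK.
by congr csum; apply/funext => k /=; rewrite echarN opprK.
Qed.

Lemma wsum_shift a (j : 'rV[int]_d) t : csummable a ->
  wsum (fun k => a (k + j)) t = echar (- j) t * wsum a t.
Proof.
move=> sa; rewrite /wsum -csumZ; last exact: csummable_wsum.
have be : bijective (fun k => k + j).
  by exists (fun k => k - j) => k; [exact: addrK|exact: subrK].
rewrite [RHS](reindex_csum _ be); congr csum; apply/funext => k /=.
by rewrite mulrCA -echarD (addrC (- j)) addrK.
Qed.

Lemma wsum_reflect a (j : 'rV[int]_d) t : csummable a ->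
  wsum (fun k => a (j - k)) t = echar j t * wsum a (- t).
Proof.
move=> sa; rewrite /wsum -csumZ; last exact: csummable_wsum.
have be : bijective (fun k => j - k) by exists (fun k => j - k) => k; exact: subKr.
rewrite [RHS](reindex_csum _ be); congr csum; apply/funext => k /=.
by rewrite mulrCA -echarN -echarD subKr.
Qed.

Lemma csummable_shift a (j : 'rV[int]_d) :
  csummable a -> csummable (fun k => a (k + j)).
Proof.
rewrite /csummable (@reindex_l1 _ _ _ (fun k => k + j))//.
by exists (fun k => k - j) => k; [exact: addrK|exact: subrK].
Qed.

Lemma l1N a : l1 (fun k => a (- k)) = l1 a.
Proof. by rewrite [RHS](@reindex_l1 _ _ _ -%R)//; exists -%R; exact: opprK. Qed.

Lemma wiener_wsumN a (M : R) :
  (l1 a <= M%:E)%E -> wiener setT (fun t => wsum a (- t)) M.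
Proof.
move=> aM; exists (fun k => a (- k)); split=> [k []//||t].
- by rewrite l1N.
- exact: wsumN.
Qed.

Lemma l1_reflect a (j : 'rV[int]_d) : l1 (fun k => a (j - k)) = l1 a.
Proof.
rewrite [RHS](@reindex_l1 _ _ _ (fun k => j - k))//.
by exists (fun k => j - k) => k; exact: subKr.
Qed.

Lemma continuous_Re_wsum a : csummable a ->
  continuous (fun t => complex.Re (wsum a t)).
Proof.
move=> sa; apply: continuous_unif_limit => e e0.
have [s us sE] := csummable_tail sa e0.
exists (fun t => complex.Re (\sum_(k <- s) a k * echar k t)).
  under eq_fun do
    rewrite (big_morph (@complex.Re R) (@cReD R) (erefl : complex.Re 0 = 0)).
  apply: continuous_big => [|k _]; first exact: add_continuous.
  under eq_fun do rewrite echarE cReM /=.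
  move=> t; apply: (@continuous_comp _ _ _ (phase k)
    (fun x => complex.Re (a k) * cos x - complex.Im (a k) * sin x)).
    exact: continuous_phase.
  by apply: cvgB; apply: cvgMl_tmp; [exact: continuous_cos|exact: continuous_sin].
move=> t; have -> : complex.Re (wsum a t) -
    complex.Re (\sum_(k <- s) a k * echar k t) =
    complex.Re (wsum a t - \sum_(k <- s) a k * echar k t).
  by apply/eqP; rewrite subr_eq -cReD subrK.
by apply: le_trans (normr_Re _) _; exact: wsum_approx.
Qed.

Lemma unit_representative (x : 'rV[R]_d) : exists m : 'rV[int]_d,
  forall i, 0 <= (x + map_mx intr m) 0 i <= 1.
Proof.
exists (\row_i (- Num.floor (x 0 i))) => i; rewrite !mxE rmorphN /=.
have /andP[] := floor_itv (x 0 i); rewrite intrD; lra.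
Qed.

(** The series is periodic and continuous, so its minimum over the compact unit cube is attained and
    is global. The logarithm series needs this uniform bound rather than pointwise positivity. *)
Lemma wsum_lower_bound a : csummable a ->
  (forall t, 0 < complex.Re (wsum a t)) ->
  exists2 c : R, 0 < c & forall t, c <= complex.Re (wsum a t).
Proof.
move=> sa apos; pose Q := [set t : 'rV[R]_d | forall i, `[0, 1]%classic (t ord0 i)].
have cQ : compact Q.
  by apply: (@rV_compact R d (fun=> `[0, 1]%classic)) => i; exact: segment_compact.
have Q0 : Q !=set0 by exists 0 => i; rewrite /= in_itv /= mxE lexx ler01.
have cf : {within Q, continuous (fun t => complex.Re (wsum a t))}.
  by apply: continuous_subspaceT; exact: continuous_Re_wsum.
have [c _ Hc] := EVT_min_rV Q0 cQ cf.
exists (complex.Re (wsum a c)) => [|t]; first exact: apos.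
have [m Hm] := unit_representative t.
have -> : wsum a t = wsum a (t + map_mx intr m).
  by rewrite /wsum; under [in RHS]eq_fun do rewrite /echar torus_pt_periodic.
by apply: Hc; rewrite inE => i /=; rewrite in_itv /= Hm.
Qed.

End SeriesOnTorus.

(** * The cardinal symbol, its factorization and the deviation estimate *)

Section BasisFunction.
Context {R : realType} {d : nat} (phi : 'rV[R]_d.+1 -> R).
Hypothesis phi_symmetric : forall x, phi (- x) = phi x.
Hypothesis phi_shift_norm : (shift_norm phi < +oo)%E.

Lemma lattice_ptD k l : lattice_pt (k + l) = lattice_pt k + lattice_pt l :> 'rV[R]_d.+1.
Proof. by apply/rowP => i; rewrite !mxE rmorphD. Qed.

Lemma lattice_ptN k : lattice_pt (- k) = - lattice_pt k :> 'rV[R]_d.+1.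
Proof. by apply/rowP => i; rewrite !mxE rmorphN. Qed.

(** The supremum in [shift_norm] runs over the unit cube only, but each value [phi x] is one of the
    summands at an integer translate of [x] lying in that cube. *)
Lemma phi_bounded : exists B : R, forall x, `|phi x| <= B.
Proof.
exists (fine (shift_norm phi)) => x.
have [m Hm] := unit_representative x.
have le1 : ((`|phi x|)%:E <= shift_norm phi)%E.
  apply: le_trans (ereal_sup_ubound _); last by exists (x + map_mx intr m).
  apply: esum_ge; exists [set m]; first by split.
  by rewrite fsbig_set1 addrK.
have ge0 : (0 <= shift_norm phi)%E by apply: le_trans le1; rewrite lee_fin.
by rewrite -lee_fin fineK// ge0_fin_numE.
Qed.

Lemma csummable_samples : csummable (fun k => (phi (lattice_pt k))%:C).
Proof.
apply: le_lt_trans phi_shift_norm; apply: le_trans (ereal_sup_ubound _).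
  2: by exists 0 => // i; rewrite mxE lexx ler01.
apply: le_esum => k _.
by rewrite normcR sub0r phi_symmetric.
Qed.

Hypothesis symbol_gt0 : forall z, torus z -> 0 < cardinal_symbol phi z.

(** In [R[i]] the relation [0 < z] forces [z] to be real, so the symbol is a positive real function
    [s] of the angles. Symmetry of [phi] makes [s] even. *)
Lemma symbol_spec : exists s : 'rV[R]_d.+1 -> R, [/\
  forall t, cardinal_symbol phi (torus_pt t) = (s t)%:C,
  forall t, 0 < s t & forall t, s (- t) = s t].
Proof.
exists (fun t => complex.Re (cardinal_symbol phi (torus_pt t))); split=> t.
- have := symbol_gt0 (torus_torus_pt t).
  by case: (cardinal_symbol _ _) => x y; rewrite ltcE /= => /andP[/eqP -> _].
- have := symbol_gt0 (torus_torus_pt t).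
  by case: (cardinal_symbol _ _) => x y; rewrite ltcE /= => /andP[_].
- have E : (fun k => (phi (lattice_pt (- k)))%:C) = fun k => (phi (lattice_pt k))%:C.
    by apply/funext => k; rewrite lattice_ptN phi_symmetric.
  have N := wsumN (fun k => (phi (lattice_pt k))%:C) t; rewrite E in N.
  exact: (@congr1 _ _ (@complex.Re R) (cardinal_symbol phi (torus_pt (- t)))
    (cardinal_symbol phi (torus_pt t)) N).
Qed.

(** The minus sign appears because omega is 1/s. Evenness of [lam] is what lets half of the
    logarithm and its reflection add up to the whole. *)
Lemma log_coef : exists (s : 'rV[R]_d.+1 -> R) (lam : 'rV[int]_d.+1 -> R[i]),
  [/\ forall t, 0 < s t /\ omega phi (torus_pt t) = ((s t)^-1)%:C,
  csummable lam,
  forall t, (- ln (s t))%:C = wsum lam t,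
  fourier_coef (log_omega phi) = lam & forall k, lam (- k) = lam k].
Proof.
have [s [sE s0 sN]] := symbol_spec.
pose c k := (phi (lattice_pt k))%:C.
have sc : csummable c := csummable_samples.
have cE t : (s t)%:C = wsum c t by rewrite -sE.
have oE t : omega phi (torus_pt t) = ((s t)^-1)%:C by rewrite /omega sE fmorphV.
have lE t : log_omega phi (torus_pt t) = (- ln (s t))%:C.
  by rewrite /log_omega oE /= lnV// posrE.
have ReE t : s t = complex.Re (wsum c t) by rewrite -cE.
have [|e e0 He] := wsum_lower_bound sc; first by move=> t; rewrite -ReE.
have W : wiener setT (fun t => (s t)%:C) (fine (l1 c)).
  by exists c; split=> // [k []|]//; rewrite -csummableE.
have [|N WN] := wiener_ln W e0; first by move=> t; rewrite ReE.
have [lam [_ lamN lamE]] := wienerZ (-1) WN; have slam := csummable_le lamN.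
have HE t : (- ln (s t))%:C = wsum lam t by rewrite -lamE mulN1r rmorphN.
exists s, lam; split=> // [|k].
  by apply/funext => k; apply: fourier_coefE => // t; rewrite lE.
have slamN : csummable (fun k => lam (- k)).
  by rewrite /csummable l1N.
suff : (fun k => lam (- k)) = lam by move=> /(congr1 (@^~ k)).
by apply: wsum_inj => // t; rewrite -wsumN -!HE sN.
Qed.

Section HalfSpace.
Variable H : half_space d.
Let Hs := half_lattice H.

Hypothesis H0 : Hs 0.
Hypothesis HD : forall k l, Hs k -> Hs l -> Hs (k + l).

(** The factor with which each coefficient of log omega enters [Lambda_plus]: 1/2 on the boundary
    layer, 1 on the rest of H, 0 outside. The hypotheses below are all that the two kinds of
    half-space need to share. *)
Variable w : 'rV[int]_d.+1 -> R[i].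
Hypothesis w_le1 : forall k, normc (w k) <= 1.
Hypothesis w_supp : forall k, ~ Hs k -> w k = 0.
Hypothesis w_sym : forall k, w k + w (- k) = 1.
Hypothesis LambdaE : forall t, csummable (fourier_coef (log_omega phi)) ->
  Lambda_plus phi H (torus_pt t) =
  csum setT (fun k => w k * (fourier_coef (log_omega phi) k * echar k t)).

(** By [w_sym] and the evenness of [lam], [mu k + mu (- k) = lam k], so the exponents at t and - t
    add up to log omega. *)
Lemma omega_plus_factor : exists gam, [/\ csummable gam,
  forall k, ~ Hs k -> gam k = 0,
  forall t, omega_plus phi H (torus_pt t) = wsum gam t &
  forall t, omega phi (torus_pt t) = wsum gam t * wsum gam (- t)].
Proof.
have [s [lam [sP slam lamE coefE lamN]]] := log_coef.
pose mu k := w k * lam k.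
have smu : csummable mu.
  by apply: le_csummable slam => k; rewrite normcM ler_piMl// normc_ge0.
have LE t : Lambda_plus phi H (torus_pt t) = wsum mu t.
  rewrite LambdaE coefE//.
  by congr csum; apply/funext => m; rewrite mulrA.
have muW : wiener Hs (wsum mu) (fine (l1 mu)).
  exists mu; split=> //; last by rewrite -csummableE.
  by move=> k /w_supp wk; rewrite /mu wk mul0r.
have [gam [gamH gamN gamE]] := wiener_cexp H0 HD muW.
exists gam; split=> //; first exact: csummable_le gamN.
  by move=> t; rewrite /omega_plus LE.
move=> t; rewrite -!gamE -cexpD wsumN /wsum -csumD; last 2 first.
- exact: csummable_wsum.
- by apply: csummable_wsum; rewrite /csummable l1N.
have -> : csum setT (fun k => mu k * echar k t + mu (- k) * echar k t) = wsum lam t.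
  congr csum; apply/funext => k.
  by rewrite /mu lamN -!mulrA -mulrDl w_sym mul1r.
have [st ->] := sP t.
by rewrite -lamE cexp_real expRN lnK// posrE.
Qed.

(** [K] is the product of a bound on |phi| and the norm of omega_+. Neither [gam] nor [K] depends on
    [j], so only the tail of [gam] has to be controlled in the limit. *)
Lemma deviation_bound : exists2 gam : 'rV[int]_d.+1 -> R[i],
  csummable gam /\ (forall k, ~ Hs k -> gam k = 0) &
  exists2 K : R, 0 <= K & forall (j : 'rV[int]_d.+1) (e : R),
    (l1 (fun m : 'rV[int]_d.+1 => if (j - m)%R \in Hs then 0%R else gam m) <= e%:E)%E ->
    (sup_deviation phi H j <= (K * e)%:E)%E.
Proof.
have [gam [sg gH opE oE]] := omega_plus_factor.
have [B HB] := phi_bounded.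
have B0 : 0 <= B := le_trans (normr_ge0 _) (HB 0).
set G := fine (l1 gam); have gG : (l1 gam <= G%:E)%E by rewrite -csummableE.
have G0 : 0 <= G by rewrite fine_ge0// l1_ge0.
have gamW : wiener Hs (wsum gam) G by exists gam.
exists gam => //; exists (B * G) => [|j e He]; first exact: mulr_ge0.
pose psi y := monomial j y * omega_plus phi H (vinv y).
have srefl : csummable (fun k => gam (j - k)) by rewrite /csummable l1_reflect.
have psiE k : fourier_coef psi k = gam (j - k).
  apply: (@fourier_coefE _ _ psi (fun k => gam (j - k))) => // t.
  by rewrite /psi vinv_torus_pt opE wsum_reflect.
(* Coefficients of P_+(z^j omega_+(1/z)). *)
pose p k := if k \in Hs then gam (j - k) else 0.
have sp : csummable p.
  apply: le_csummable srefl => k; rewrite /p; case: ifP => // _.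
  by rewrite normc0 normc_ge0.
have PE t : P_plus H psi (torus_pt t) = wsum p t.
  rewrite /P_plus csum_mkcond; congr csum; apply/funext => k; rewrite /p psiE.
  by case: ifP => // _; rewrite mul0r.
have pW : wiener Hs (wsum p) (fine (l1 p)).
  exists p; split=> [k Hk||]//; last by rewrite -csummableE.
  by rewrite /p memNset.
have [al [alH alN alE]] := wienerM HD gamW pW; have sal := csummable_le alN.
have semiE : fourier_coef (semi_symbol phi H j) = al.
  apply/funext => k; apply: fourier_coefE => // t.
  by rewrite /semi_symbol opE PE alE.
have gNW := wiener_wsumN gG.
have setTD : forall k l : 'rV[int]_d.+1, Hs k -> setT l -> setT (k + l) by [].
have [a0 [_ a0N a0E]] := wienerM setTD gamW gNW; have sa0 := csummable_le a0N.
have omE : fourier_coef (omega phi) = a0.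
  by apply/funext => k; apply: fourier_coefE => // t; rewrite oE a0E.
pose q m := if j - m \in Hs then 0 else gam m.
have sq : csummable q := csummable_le He.
(* The reflection k -> j - k maps [p] to the part [p'] of [gam] with j - m in H, and [q] is the
   complementary part. *)
have split_gam t : wsum gam (- t) = wsum q (- t) + echar (- j) t * wsum p t.
  pose p' m := if j - m \in Hs then gam m else 0.
  have sp' : csummable p'.
    by apply: le_csummable sg => k; rewrite /p'; case: ifP; rewrite ?normc0 ?normc_ge0.
  have -> : p = fun k => p' (j - k) by apply/funext => k; rewrite /p' subKr.
  rewrite wsum_reflect// mulrA -echarD addNr echar0 mul1r /wsum -csumD.
  - congr csum; apply/funext => k; rewrite -mulrDl /q /p'.
    by case: ifP; rewrite ?addr0 ?add0r.
  - exact: csummable_wsum.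
  - exact: csummable_wsum.
have qW := wiener_wsumN He.
(* [dl] holds the coefficients of omega_+(z) times the series of [q] at 1/z, with norm at most
   [G * e]. By [dE] these are the coefficients of omega - z^-j omega_j. *)
have [dl [_ dlN dlE]] := wienerM setTD gamW qW; have sdl := csummable_le dlN.
have dE k : dl k = a0 k - al (k + j).
  suff : dl = fun k => a0 k + (-1) * al (k + j).
    by move=> /(congr1 (@^~ k)) ->; rewrite mulN1r.
  have salj := csummable_shift j sal.
  apply: wsum_inj => [||t]//; first by apply: csummableD => //; exact: csummableZ.
  have -> : wsum (fun k => a0 k + (-1) * al (k + j)) t =
      wsum a0 t - echar (- j) t * wsum al t.
    rewrite -wsum_shift// -[X in _ = _ + X]mulN1r /wsum -csumZ ?csumD//.
    - by rewrite -csumD; [congr csum; apply/funext => m; ring|..];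
        [exact: csummable_wsum|apply: csummableZ; exact: csummable_wsum].
    - exact: csummable_wsum.
  have alg (g y n z x D A L : R[i]) : g * y = D -> g * n = A -> g * z = L ->
      n = y + x * z -> D = A - x * L.
    by move=> <- <- <- ->; ring.
  exact: alg (dlE t) (a0E t) (alE t) (split_gam t).
apply: ge_ereal_sup => _ [x _ <-]; rewrite lee_fin.
have bsum (a : 'rV[int]_d.+1 -> R[i]) (y : 'rV[R]_d.+1) N : (l1 a <= N%:E)%E ->
    (l1 (fun k => a k * (phi (y - lattice_pt k))%:C)%R <= (B * N)%:E)%E.
  move=> aN; apply: (@le_trans _ _ (l1 (fun k => B%:C * a k))).
    apply: le_l1 => k; rewrite mulrC !normcM !normcR (ger0_norm B0).
    by rewrite ler_wpM2r ?normc_ge0.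
  by rewrite l1Z normcR (ger0_norm B0) EFinM lee_wpmul2l// lee_fin.
(* The substitution k -> k + j cancels the translation by [lattice_pt j]. The sum may run over all
   of Z^d because [al] vanishes outside H. *)
have -> : semi_lagrange phi H j (x + lattice_pt j) =
    csum setT (fun k => al (k + j) * (phi (x - lattice_pt k))%:C).
  rewrite /semi_lagrange semiE csum_mkcond.
  have be : bijective (fun k : 'rV[int]_d.+1 => k + j).
    by exists (fun k => k - j) => k; [exact: addrK|exact: subrK].
  rewrite [LHS](reindex_csum _ be); congr csum; apply/funext => k /=.
  case: ifPn => [_|]; last by rewrite notin_setE => /alH ->; rewrite mul0r.
  by rewrite lattice_ptD opprD addrACA subrr addr0.
have -> : Defs.lagrange phi x = csum setT (fun k => a0 k * (phi (x - lattice_pt k))%:C).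
  by rewrite /Defs.lagrange omE.
have salj := csummable_shift j sal.
have s1 := csummable_le (bsum a0 x _ a0N).
have s2 : csummable (fun k => al (k + j) * (phi (x - lattice_pt k))%:C).
  apply: (csummable_le (bsum _ x (fine (l1 (fun k => al (k + j)))) _)).
  by rewrite -csummableE.
rewrite -csumN// -csumD//; last first.
  by apply: le_csummable s2 => k; rewrite normc_opp.
rewrite -mulrA; apply: normc_csum; apply: le_trans (bsum _ x _ dlN).
by apply: le_l1 => k; rewrite dE mulrBl.
Qed.

Lemma sup_deviation_ge0 j : (0 <= sup_deviation phi H j)%E.
Proof.
apply: le_trans (ereal_sup_ubound _); last by exists 0.
by rewrite lee_fin normc_ge0.
Qed.

(** The terms of [gam] outside a finite set are small uniformly in [j]; the finitely many others in
    H satisfy j n - m in H from some n on and drop out. *)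
Lemma sup_deviation_cvg0 (j : nat -> 'rV[int]_d.+1) :
  (forall m, Hs m -> exists N, forall n, (N <= n)%N -> Hs (j n - m)) ->
  sup_deviation phi H (j n) @[n --> \oo] --> 0%E.
Proof.
move=> jH; have [gam [sg gH] [K K0 HK]] := deviation_bound.
have jHs (s : seq 'rV[int]_d.+1) : exists N, forall n m, (N <= n)%N ->
    m \in s -> Hs m -> Hs (j n - m).
  elim: s => [|m s [N HN]]; first by exists 0%N.
  have [Hm|Hm] := pselect (Hs m).
    have [N' HN'] := jH m Hm; exists (maxn N N') => n m'.
    rewrite geq_max inE => /andP[Nn N'n] /predU1P[-> _|]; first exact: HN'.
    exact: HN.
  exists N => n m' Nn; rewrite inE => /predU1P[->//|]; exact: HN.
have small (e : R) : 0 < e ->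
    \forall n \near \oo, (sup_deviation phi H (j n) <= (K * e)%:E)%E.
  move=> e0; have [s us sE] := csummable_tail sg e0; have [N HN] := jHs s.
  exists N => // n /= Nn; apply: HK; apply: le_trans sE; apply: le_l1 => m.
  case: ifPn => [_|]; first by rewrite normc0 normc_ge0.
  rewrite notin_setE; case: ifPn => // ms Hjm.
  have [Hm|/gH ->] := pselect (Hs m); last by rewrite normc0.
  by case: Hjm; exact: HN.
(* The deviation is an extended real, so convergence to 0 also requires it to be finite
   eventually. *)
have fin_dev (e : R) n : (sup_deviation phi H (j n) <= (K * e)%:E)%E ->
    sup_deviation phi H (j n) \is a fin_num.
  move=> le; rewrite ge0_fin_numE ?sup_deviation_ge0//.
  by apply: le_lt_trans le _; rewrite ltry.
apply/fine_cvgP; split.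
  by apply: filterS (small 1 ltr01) => n; exact: fin_dev.
apply/cvgrPdist_le => e e0.
(* [K] may be 0, so [e] is divided by [K + 1]. *)
have K1 : 0 < K + 1 by lra.
have eK : 0 < e / (K + 1) by rewrite divr_gt0.
apply: filterS (small _ eK) => n Hn /=.
rewrite sub0r normrN ger0_norm ?fine_ge0 ?sup_deviation_ge0//.
rewrite -lee_fin fineK ?(fin_dev _ _ Hn)//; apply: le_trans Hn _.
rewrite lee_fin (_ : K * _ = e * (K / (K + 1))); last by ring.
apply: ler_piMr; first exact: ltW.
by rewrite ler_pdivrMr// mul1r; lra.
Qed.

End HalfSpace.
End BasisFunction.

(** * The weight that halves the logarithm *)

Section HalfWeight.
Context {R : realType} {d : nat}.
Variables D0 D1 : set 'rV[int]_d.
Implicit Types k : 'rV[int]_d.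

(** [D0] is the symmetric boundary layer and [D1] the strictly positive part. Two indicators are
    added so that the weighted sum separates into the two sums of [Lambda_plus]. *)
Definition half_weight k : R[i] :=
  (if k \in D0 then 2^-1 else 0) + (if k \in D1 then 1 else 0).

Hypothesis D01 : forall k, D0 k -> ~ D1 k.
Hypothesis D0N : forall k, D0 k -> D0 (- k).
Hypothesis D1N : forall k, D1 k -> ~ D1 (- k).
Hypothesis DT : forall k, [\/ D0 k, D1 k | D1 (- k)].

Lemma half_weightD0 k : D0 k -> half_weight k = 2^-1.
Proof.
by move=> k0; rewrite /half_weight mem_set// memNset ?addr0//; exact: D01.
Qed.

Lemma half_weightD1 k : D1 k -> half_weight k = 1.
Proof.
move=> k1; rewrite /half_weight memNset ?mem_set ?add0r//.
by move=> /D01.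
Qed.

Lemma half_weightN k : D1 (- k) -> half_weight k = 0.
Proof.
move=> k1; rewrite /half_weight memNset ?memNset ?addr0//.
  by move=> /D1N.
by move=> /D0N /D01.
Qed.

Lemma half_weight_le1 k : normc (half_weight k) <= 1.
Proof.
case: (DT k) => [/half_weightD0|/half_weightD1|/half_weightN] ->.
- by rewrite normcV normc_nat invf_le1// ler1n.
- by rewrite normc1.
- by rewrite normc0.
Qed.

Lemma half_weight_sym k : half_weight k + half_weight (- k) = 1.
Proof.
case: (DT k) => kD.
- rewrite !half_weightD0//; last exact: D0N.
  by field.
- by rewrite half_weightD1// half_weightN ?opprK// addr0.
- by rewrite half_weightN// half_weightD1// add0r.
Qed.

Lemma half_weight_csum (f : 'rV[int]_d -> R[i]) : csummable f ->
  2^-1 * csum D0 f + csum D1 f = csum setT (fun k => half_weight k * f k).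
Proof.
move=> sf; have sD (D : set 'rV[int]_d) : csummable (fun k => if k \in D then f k else 0).
  by apply: le_csummable sf => k; case: ifP; rewrite ?normc0 ?normc_ge0.
rewrite (csum_mkcond D0) (csum_mkcond D1) -(csumZ _ (sD D0)) -csumD//; last first.
  exact: csummableZ.
congr csum; apply/funext => k; rewrite /half_weight.
by case: ifP; case: ifP => _ _; ring.
Qed.

End HalfWeight.

(** * The two kinds of half-space lattice *)

Section Main.
Context {R : realType} {d : nat} (phi : 'rV[R]_d.+1 -> R).
Hypothesis phi_symmetric : forall x, phi (- x) = phi x.
Hypothesis phi_shift_norm : (shift_norm phi < +oo)%E.
Hypothesis symbol_gt0 : forall z, torus z -> 0 < cardinal_symbol phi z.

Lemma ordered_deviation_cvg0 (le : rel 'rV[int]_d.+1) (j : nat -> 'rV[int]_d.+1) :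
  lattice_order le ->
  (forall n, is_maximum le (finite_section R (OrderedHalf le) n) (j n)) ->
  sup_deviation phi (OrderedHalf le) (j n) @[n --> \oo] --> 0%E.
Proof.
move=> [le_total le_anti le_tr le_add] jmax.
have leN k : le k 0 -> le 0 (- k) by move=> /(le_add _ _ (- k)); rewrite subrr add0r.
have leN' k : le 0 (- k) -> le k 0 by move=> /(le_add _ _ k); rewrite add0r addNr.
pose D0 : set 'rV[int]_d.+1 := [set 0].
pose D1 : set 'rV[int]_d.+1 := [set k | le 0 k /\ k <> 0].
have D01 k : D0 k -> ~ D1 k by move=> -> [].
have D0N k : D0 k -> D0 (- k) by move=> ->; rewrite /D0 /= oppr0.
have D1N k : D1 k -> ~ D1 (- k).
  by move=> [k1 k0] [k2 _]; apply: k0; apply: le_anti; rewrite k1 leN'.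
have DT k : [\/ D0 k, D1 k | D1 (- k)].
  have [->|/eqP k0] := eqVneq k 0; first exact: Or31.
  have /orP[k1|k1] := le_total 0 k; first exact: Or32.
  apply: Or33; split; first exact: leN.
  by move=> /eqP; rewrite oppr_eq0 => /eqP.
have le00 : le 0 0 by have := le_total 0 0; rewrite orbb.
apply: (@sup_deviation_cvg0 R d phi phi_symmetric phi_shift_norm symbol_gt0
  (OrderedHalf le) le00 _ (half_weight D0 D1)).
- by move=> k l /= k0 l0; apply: le_tr l0 _; rewrite -[X in le X _]add0r; exact: le_add.
- exact: half_weight_le1.
- move=> k /= kH; case: (DT k) => [k0|[//]|k1]; last exact: half_weightN.
  by case: kH; rewrite k0.
- exact: half_weight_sym.
- move=> t sl; rewrite -half_weight_csum; last exact: csummable_wsum.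
  rewrite /Lambda_plus; congr (2^-1 * _ + _).
  (* For a total order the boundary layer is the single point 0, where the character is 1, so its
     sum is the constant term of the logarithm. *)
  rewrite csum_mkcond -[LHS](csum_delta (0 : 'rV[int]_d.+1)); congr csum.
  apply/funext => k; rewrite in_set1.
  by case: eqP => // ->; rewrite echar0 mulr1.
(* As soon as n is at least the norm of m, m belongs to the n-th finite section and lies below its
   maximum [j n]; compatibility with addition then puts j n - m in H. *)
move=> m /= m0; pose x : R := enorm (lattice_pt m : 'rV[R]_d.+1).
have x0 : 0 <= x by exact: sqrtr_ge0.
exists (Num.bound x) => n Nn; have [_ /(_ m)] := jmax n.
have mn : finite_section R (OrderedHalf le) n m.
  by split=> //; rewrite -/x (le_trans (ltW (archi_boundP x0)))// ler_nat.
by move=> /(_ mn)/(le_add _ _ (- m)); rewrite subrr.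
Qed.

Lemma product_deviation_cvg0 :
  sup_deviation phi (ProductHalf d) (vertical_pt d n) @[n --> \oo] --> 0%E.
Proof.
pose D0 := [set k : 'rV[int]_d.+1 | k 0 ord_max = 0].
pose D1 := [set k : 'rV[int]_d.+1 | 0 < k 0 ord_max].
have D01 k : D0 k -> ~ D1 k by rewrite /D0 /D1 /= => ->; rewrite ltxx.
have D0N k : D0 k -> D0 (- k) by rewrite /D0 /= mxE => ->; rewrite oppr0.
have D1N k : D1 k -> ~ D1 (- k).
  by rewrite /D1 /= mxE oppr_gt0 => k1; apply/negP; rewrite -leNgt ltW.
have DT k : [\/ D0 k, D1 k | D1 (- k)].
  rewrite /D0 /D1 /= mxE oppr_gt0.
  by case: (ltrgtP (k 0 ord_max) 0) => ?; [exact: Or33|exact: Or32|exact: Or31].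
apply: (@sup_deviation_cvg0 R d phi phi_symmetric phi_shift_norm symbol_gt0
  (ProductHalf d) _ _ (half_weight D0 D1)).
- by rewrite /= mxE.
- by move=> k l /= k0 l0; rewrite mxE addr_ge0.
- exact: half_weight_le1.
- move=> k /= kH; case: (DT k) => [k0|k1|]; last exact: half_weightN.
    by case: kH; rewrite k0.
  by case: kH; exact: ltW.
- exact: half_weight_sym.
- move=> t sl; rewrite -half_weight_csum//; exact: csummable_wsum.
(* Only the last coordinate n - m_d of the difference matters, and it is nonnegative once n >=
   |m_d|. *)
move=> m _; exists (absz (m 0 ord_max)) => n mn /=.
by rewrite !mxE eqxx subr_ge0 (le_trans (ler_norm _))// -abszE lez_nat.
Qed.

End Main.

Theorem theorem4p2 (R : realType) (d : nat) (phi : 'rV[R]_d.+1 -> R)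
    (phi_continuous : continuous phi)
    (phi_symmetric : forall x, phi (- x) = phi x)
    (phi_shift_norm : (shift_norm phi < +oo)%E)
    (symbol_gt0 : forall z, torus z -> 0 < cardinal_symbol phi z) :
  (forall le : rel 'rV[int]_d.+1, lattice_order le ->
     forall j : nat -> 'rV[int]_d.+1,
     (forall n, is_maximum le (finite_section R (OrderedHalf le) n) (j n)) ->
     sup_deviation phi (OrderedHalf le) (j n) @[n --> \oo] --> 0%E)
  /\
  (sup_deviation phi (ProductHalf d) (vertical_pt d n) @[n --> \oo] --> 0%E).
Proof.
split; last exact: product_deviation_cvg0.
by move=> le le_order j; exact: ordered_deviation_cvg0.
Qed.
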